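(* On the Carnot group $\mathfrak{G}$ (described in the context) with the left-invariant Finsler norm given, for $\xi=(\xi_1,\dots,\xi_6)\in T_x\mathfrak{G}$, by $$\|\xi\|=\max(|\xi_1|,|\xi_2|)+|\xi_3+x_2\xi_1|+|\xi_4+x_3\xi_1|+|\xi_5-x_1\xi_4|+\big|\xi_6+\tfrac12x_3^2\xi_1+(x_1x_2+x_3)\xi_4-x_2\xi_5\big|,$$ there exist pairs of points such that they are connected by a unique shortest path, and this shortest path exhibits chattering.
   Context: The group $\mathfrak{G}$ is $\mathbb{R}^6=\{x=(x_1,\dots,x_6)\}$ with multiplication $z=x*y$ given by $z_1=x_1+y_1$, $z_2=x_2+y_2$, $z_3=x_3+y_3-x_2y_1$, $z_4=x_4+y_4-x_3y_1+\frac12x_2y_1^2$, $z_5=x_5+y_5+x_1y_4-x_1x_3y_1+\frac13x_2y_1^3-\frac12x_3y_1^2+\frac12x_1x_2y_1^2$, $z_6=x_6+y_6-x_3y_4+x_2y_5+\frac12x_3^2y_1-\frac12x_2x_3y_1^2+\frac16x_2^2y_1^3$. It is a simply connected Carnot group of step 5 with growth vector $(2,1,1,1,1)$. The vector fields $g_1=(1,0,-x_2,-x_3,-x_1x_3,\frac12x_3^2)$, $g_2=(0,1,0,0,0,0)$, $g_3=(0,0,1,0,0,0)$, $g_4=(0,0,0,1,x_1,-x_3)$, $g_5=(0,0,0,0,1,x_2)$, $g_6=(0,0,0,0,0,1)$ form a basis of left-invariant vector fields, with nontrivial brackets $[g_1,g_2]=g_3$, $[g_1,g_3]=g_4$, $[g_1,g_4]=g_5$,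 $[g_2,g_5]=-[g_3,g_4]=g_6$. The unit ball of the norm at $x$ is the hyperoctahedron $B(x)=\mathrm{conv}(\pm g_1(x)\pm g_2(x);\pm g_3(x);\pm g_4(x);\pm g_5(x);\pm g_6(x))$ with 12 vertices. The length of an absolutely continuous curve is $\int\|\dot x\|\,dt$; a shortest path is a curve of minimal length among curves connecting its endpoints (uniqueness is understood for naturally parameterized curves, $\|\dot x\|=1$, i.e. solutions of the time-optimal problem with $\dot x\in B(x)$, where $\dot x$ is written as a convex combination of the vertices of $B(x)$ and the coefficients are the control). A path exhibits chattering if its control has a countably infinite number of switches (jumps between vertices) on arbitrarily small time intervals, i.e. infinitely many switches accumulating at some time moment. *)

(* Defs.v *)
From HB Require Import structures.
From mathcomp Require Import all_boot all_order all_algebra.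
From mathcomp Require Import all_classical all_reals all_analysis.
From mathcomp Require Import ring lra.

Set Implicit Arguments.
Unset Strict Implicit.
Unset Printing Implicit Defensive.

Import Order.TTheory GRing.Theory Num.Theory.
Import numFieldNormedType.Exports.

Local Open Scope classical_set_scope.
Local Open Scope ring_scope.

(* Coordinates of R^6 are numbered from 1, so that x@_k is x_k for 1 <= k <= 6. *)
Definition crd {R : Type} (x : 'rV[R]_6) (k : nat) : R := x ord0 (inord k.-1).
Notation "x @_ k" := (crd x k) (at level 3, k at level 2, left associativity,
  format "x @_ k") : ring_scope.

Definition vec6 {R : nmodType} (a1 a2 a3 a4 a5 a6 : R) : 'rV[R]_6 :=
  \row_(i < 6) [:: a1; a2; a3; a4; a5; a6]`_i.

Lemma vec6E {R : nmodType} (a1 a2 a3 a4 a5 a6 : R) :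
  let a := vec6 a1 a2 a3 a4 a5 a6 in
  (a@_1 = a1) * (a@_2 = a2) * (a@_3 = a3) *
  (a@_4 = a4) * (a@_5 = a5) * (a@_6 = a6).
Proof. by rewrite /= /crd !mxE !inordK. Qed.

Lemma crdP {R : Type} (x y : 'rV[R]_6) :
  x@_1 = y@_1 -> x@_2 = y@_2 -> x@_3 = y@_3 ->
  x@_4 = y@_4 -> x@_5 = y@_5 -> x@_6 = y@_6 -> x = y.
Proof.
move=> e1 e2 e3 e4 e5 e6; apply/rowP => i; rewrite -[i]inord_val.
by case: i => -[|[|[|[|[|[|]]]]]].
Qed.

Lemma crdD {R : nmodType} (x y : 'rV[R]_6) k : (x + y)@_k = x@_k + y@_k.
Proof. by rewrite /crd mxE. Qed.

Lemma crdZ {R : pzRingType} (c : R) (x : 'rV[R]_6) k : (c *: x)@_k = c * x@_k.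
Proof. by rewrite /crd mxE. Qed.

Definition carnot (R : realType) : Type := 'rV[R]_6.

HB.instance Definition _ (R : realType) := NormedModule.on (carnot R).

Section group_law.
Variable R : realType.
Implicit Types x y z : carnot R.

Definition cmul x y : carnot R := vec6
  (x@_1 + y@_1)
  (x@_2 + y@_2)
  (x@_3 + y@_3 - x@_2 * y@_1)
  (x@_4 + y@_4 - x@_3 * y@_1 + 2^-1 * x@_2 * y@_1 ^+ 2)
  (x@_5 + y@_5 + x@_1 * y@_4 - x@_1 * x@_3 * y@_1 + 3^-1 * x@_2 * y@_1 ^+ 3
   - 2^-1 * x@_3 * y@_1 ^+ 2 + 2^-1 * x@_1 * x@_2 * y@_1 ^+ 2)
  (x@_6 + y@_6 - x@_3 * y@_4 + x@_2 * y@_5 + 2^-1 * x@_3 ^+ 2 * y@_1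
   - 2^-1 * x@_2 * x@_3 * y@_1 ^+ 2 + 6^-1 * x@_2 ^+ 2 * y@_1 ^+ 3).

Definition cunit : carnot R := vec6 0 0 0 0 0 0.

(* The solution y of cmul x y = cunit, found coordinate by coordinate. *)
Definition cinv x : carnot R :=
  let y1 := - x@_1 in
  let y4 := - x@_4 + x@_3 * y1 - 2^-1 * x@_2 * y1 ^+ 2 in
  let y5 := - x@_5 - x@_1 * y4 + x@_1 * x@_3 * y1 - 3^-1 * x@_2 * y1 ^+ 3
            + 2^-1 * x@_3 * y1 ^+ 2 - 2^-1 * x@_1 * x@_2 * y1 ^+ 2 in
  vec6 y1 (- x@_2) (- x@_3 + x@_2 * y1) y4 y5
    (- x@_6 + x@_3 * y4 - x@_2 * y5 - 2^-1 * x@_3 ^+ 2 * y1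
     + 2^-1 * x@_2 * x@_3 * y1 ^+ 2 - 6^-1 * x@_2 ^+ 2 * y1 ^+ 3).

Lemma cmulA : associative cmul.
Proof. by move=> x y z; apply: crdP; rewrite !vec6E; field. Qed.

Lemma cmul1 : left_id cunit cmul.
Proof. by move=> x; apply: crdP; rewrite !vec6E; field. Qed.

Lemma cmulr1 : right_id cunit cmul.
Proof. by move=> x; apply: crdP; rewrite !vec6E; field. Qed.

Lemma cmulV : left_inverse cunit cinv cmul.
Proof. by move=> x; apply: crdP; rewrite !vec6E; field. Qed.

Lemma cmulrV : right_inverse cunit cinv cmul.
Proof. by move=> x; apply: crdP; rewrite !vec6E; field. Qed.

End group_law.

HB.instance Definition _ (R : realType) := isGroup.Build (carnot R)
  (@cmulA R) (@cmul1 R) (@cmulr1 R) (@cmulV R) (@cmulrV R).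

Section metric.
Variable R : realType.
Implicit Types (x p q : carnot R) (xi : 'rV[R]_6).

(* gfield k is the k-th vector field for 1 <= k <= 6; other values of k are unused. *)
Definition gfield (k : nat) x : 'rV[R]_6 :=
  match k with
  | 1%N => vec6 1 0 (- x@_2) (- x@_3) (- (x@_1 * x@_3)) (2^-1 * x@_3 ^+ 2)
  | 2%N => vec6 0 1 0 0 0 0
  | 3%N => vec6 0 0 1 0 0 0
  | 4%N => vec6 0 0 0 1 x@_1 (- x@_3)
  | 5%N => vec6 0 0 0 0 1 x@_2
  | _ => vec6 0 0 0 0 0 1
  end.

Definition finsler x xi : R :=
  Num.max `|xi@_1| `|xi@_2| + `|xi@_3 + x@_2 * xi@_1| + `|xi@_4 + x@_3 * xi@_1|
  + `|xi@_5 - x@_1 * xi@_4|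
  + `|xi@_6 + 2^-1 * x@_3 ^+ 2 * xi@_1 + (x@_1 * x@_2 + x@_3) * xi@_4
      - x@_2 * xi@_5|.

(* The twelve vertices of the unit ball B(x): inl (s, t) stands for
   (-1)^s g_1(x) + (-1)^t g_2(x), and inr (k, s), with 0 <= k < 4, for
   (-1)^s g_{k+3}(x). *)
Definition vertex : finType := ((bool * bool) + ('I_4 * bool))%type.

Definition vertex_at x (v : vertex) : 'rV[R]_6 :=
  match v with
  | inl (s, t) => (-1) ^+ s *: gfield 1 x + (-1) ^+ t *: gfield 2 x
  | inr (k, s) => (-1) ^+ s *: gfield (k + 3) x
  end.

Lemma finsler_frame x (a1 a2 a3 a4 a5 a6 : R) :
  finsler x (a1 *: gfield 1 x + a2 *: gfield 2 x + a3 *: gfield 3 x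
             + a4 *: gfield 4 x + a5 *: gfield 5 x + a6 *: gfield 6 x) =
  Num.max `|a1| `|a2| + `|a3| + `|a4| + `|a5| + `|a6|.
Proof.
set xi := (X in finsler _ X).
have -> : xi = vec6 a1 a2 (a3 - a1 * x@_2) (a4 - a1 * x@_3)
   (a5 + a4 * x@_1 - a1 * (x@_1 * x@_3))
   (a6 + a5 * x@_2 - a4 * x@_3 + a1 * (2^-1 * x@_3 ^+ 2)).
  by apply: crdP; rewrite /xi !(crdD, crdZ) !vec6E; field.
rewrite /finsler !vec6E.
by congr (_ + _ + _ + _ + _); congr (`|_|); field.
Qed.

(* Left-invariance: left translations preserve the norm of velocities. *)
Lemma finsler_left_invariant (h : carnot R) (c : R -> carnot R) (t : R) xi :
  is_derive t 1 c xi ->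
  exists2 eta : 'rV[R]_6, is_derive t 1 (fun s => h * c s)%g eta &
    finsler (h * c t)%g eta = finsler (c t) xi.
Proof.
move=> dc.
have dck k : is_derive t 1 (fun s => (c s)@_k) xi@_k.
  have dct : derivable c t 1 by case: dc.
  apply: DeriveDef; first exact: (derivable_mxP _ _ _).1.
  by case: dc => _ <-; rewrite /crd derive_mx// mxE.
pose y := c t.
pose eta := vec6 xi@_1 xi@_2 (xi@_3 - h@_2 * xi@_1)
  (xi@_4 - h@_3 * xi@_1 + h@_2 * y@_1 * xi@_1)
  (xi@_5 + h@_1 * xi@_4 - h@_1 * h@_3 * xi@_1 + h@_2 * y@_1 ^+ 2 * xi@_1
   - h@_3 * y@_1 * xi@_1 + h@_1 * h@_2 * y@_1 * xi@_1)
  (xi@_6 - h@_3 * xi@_4 + h@_2 * xi@_5 + 2^-1 * h@_3 ^+ 2 * xi@_1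
   - h@_2 * h@_3 * y@_1 * xi@_1 + 2^-1 * h@_2 ^+ 2 * y@_1 ^+ 2 * xi@_1).
exists eta; last first.
  rewrite /finsler /eta [(h * c t)%g]/(cmul h y) -/y !vec6E.
  by congr (_ + _ + _ + _ + _); congr (`|_|); field.
have ext (f1 f2 : R -> R) df :
    f1 =1 f2 -> is_derive t 1 f2 df -> is_derive t 1 f1 df.
  by move=> /funext ->.
have dk k : (0 < k <= 6)%N ->
    is_derive t 1 (fun s => (cmul h (c s))@_k) eta@_k.
  case: k => [|[|[|[|[|[|[|k]]]]]]] // _;
    (eapply ext; [by move=> s; rewrite vec6E; reflexivity|]);
    apply: is_derive_eq; rewrite vec6E /y /GRing.scale /=; by field.
have dc6 : derivable (fun s => cmul h (c s)) t 1.
  apply/derivable_mxP => i j; rewrite ord1 -[j]inord_val.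
  have [] // : is_derive t 1 (fun s => (cmul h (c s))@_j.+1) eta@_j.+1.
  by apply: dk => /=.
apply: DeriveDef => //; apply/rowP => j.
rewrite derive_mx// mxE -[j]inord_val.
have [] // : is_derive t 1 (fun s => (cmul h (c s))@_j.+1) eta@_j.+1.
by apply: dk => /=.
Qed.

Lemma finsler_ball x xi : finsler x xi <= 1 <->
  exists2 u : vertex -> R, (forall v, 0 <= u v) /\ \sum_v u v = 1 &
    xi = \sum_v u v *: vertex_at x v.
Proof.
pose k0 : 'I_4 := ord0; pose k1 : 'I_4 := lift ord0 ord0.
pose k2 : 'I_4 := lift ord0 (lift ord0 ord0).
pose k3 : 'I_4 := lift ord0 (lift ord0 (lift ord0 ord0)).
have sumv (V : nmodType) (F : vertex -> V) : \sum_v F v =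
    F (inl (true, true)) + F (inl (true, false)) +
    (F (inl (false, true)) + F (inl (false, false))) +
    (F (inr (k0, true)) + F (inr (k0, false)) +
    (F (inr (k1, true)) + F (inr (k1, false)) +
    (F (inr (k2, true)) + F (inr (k2, false)) +
    (F (inr (k3, true)) + F (inr (k3, false)))))).
  rewrite big_sumType /=; congr (_ + _).
    transitivity (\sum_p F (inl (p.1, p.2))); first by apply: eq_bigr => -[].
    by rewrite -(pair_bigA _ (fun s t => F (inl (s, t)))) /= big_bool /= !big_bool.
  transitivity (\sum_p F (inr (p.1, p.2))); first by apply: eq_bigr => -[].
  rewrite -(pair_bigA _ (fun k s => F (inr (k, s)))) /=.
  by rewrite !big_ord_recl big_ord0 !big_bool addr0.
have comb (u : vertex -> R) : \sum_v u v *: vertex_at x v =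
    (u (inl (false, true)) + u (inl (false, false))
     - u (inl (true, true)) - u (inl (true, false))) *: gfield 1 x +
    (u (inl (true, false)) + u (inl (false, false))
     - u (inl (true, true)) - u (inl (false, true))) *: gfield 2 x +
    (u (inr (k0, false)) - u (inr (k0, true))) *: gfield 3 x +
    (u (inr (k1, false)) - u (inr (k1, true))) *: gfield 4 x +
    (u (inr (k2, false)) - u (inr (k2, true))) *: gfield 5 x +
    (u (inr (k3, false)) - u (inr (k3, true))) *: gfield 6 x.
  rewrite sumv /vertex_at.
  rewrite -[(k0 + 3)%N]/3%N -[(k1 + 3)%N]/4%N -[(k2 + 3)%N]/5%N -[(k3 + 3)%N]/6%N.
  move: (gfield 1 x) (gfield 2 x) (gfield 3 x) (gfield 4 x) (gfield 5 x) (gfield 6 x) => g1 g2 g3 g4 g5 g6.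
  by apply/rowP => i; rewrite !mxE; ring.
split=> [|[u [u0 u1] ->]]; last first.
  rewrite comb finsler_frame; move: u1; rewrite sumv.
  have := u0 (inl (true, true)); have := u0 (inl (true, false)).
  have := u0 (inl (false, true)); have := u0 (inl (false, false)).
  have := u0 (inr (k0, true)); have := u0 (inr (k0, false)).
  have := u0 (inr (k1, true)); have := u0 (inr (k1, false)).
  have := u0 (inr (k2, true)); have := u0 (inr (k2, false)).
  have := u0 (inr (k3, true)); have := u0 (inr (k3, false)).
  have nD (a b : R) : 0 <= a -> 0 <= b -> `|a - b| <= a + b.
    by move=> a0 b0; rewrite ler_norml; apply/andP; split; lra.
  move=> k3f k3t k2f k2t k1f k1t k0f k0t ff ft tf tt.
  have := nD _ _ k0f k0t; have := nD _ _ k1f k1t.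
  have := nD _ _ k2f k2t; have := nD _ _ k3f k3t.
  set m := Num.max _ _ => n3 n2 n1 n0 s1.
  have : m <= u (inl (true, true)) + u (inl (true, false)) +
              (u (inl (false, true)) + u (inl (false, false))).
    by rewrite /m ge_max !ler_norml; do ![apply/andP; split]; lra.
  lra.
pose a1 := xi@_1; pose a2 := xi@_2.
pose a3 := xi@_3 + x@_2 * xi@_1; pose a4 := xi@_4 + x@_3 * xi@_1.
pose a5 := xi@_5 - x@_1 * xi@_4.
pose a6 := xi@_6 + 2^-1 * x@_3 ^+ 2 * xi@_1 + (x@_1 * x@_2 + x@_3) * xi@_4
           - x@_2 * xi@_5.
have xiE : xi = a1 *: gfield 1 x + a2 *: gfield 2 x + a3 *: gfield 3 x
             + a4 *: gfield 4 x + a5 *: gfield 5 x + a6 *: gfield 6 x.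
  by apply: crdP; rewrite /a1 /a2 /a3 /a4 /a5 /a6 !(crdD, crdZ) !vec6E; field.
rewrite {1}xiE finsler_frame => le1.
pose S := 1 - `|a3| - `|a4| - `|a5| - `|a6|.
have [le1S le2S] : `|a1| <= S /\ `|a2| <= S.
  have : Num.max `|a1| `|a2| <= S by rewrite /S; lra.
  by rewrite ge_max => /andP[].
pose c := `|a1 + a2| - S.
pose a (k : 'I_4) := nth 0 [:: a3; a4; a5; a6] k.
pose u (v : vertex) : R := match v with
  | inl (s, t) =>
      4^-1 * (S + (-1) ^+ s * a1 + (-1) ^+ t * a2 + (-1) ^+ s * (-1) ^+ t * c)
  | inr (k, s) => 2^-1 * (`|a k| + (-1) ^+ s * a k) end.
exists u; [split|].
- case=> [[s t]|[k s]] /=.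
    move: le1S le2S; rewrite !ler_norml => /andP[? ?] /andP[? ?].
    by rewrite /c; case: s; case: t; case: (ger0P (a1 + a2)) => ?;
      rewrite ?expr1 ?expr0; lra.
  by case: s; case: (ger0P (a k)) => ?; rewrite ?expr1 ?expr0; lra.
- by rewrite sumv /u /a /= /S; field.
- have tw (b : R) : 2^-1 * (`|b| + 1 * b) - 2^-1 * (`|b| + - 1 * b) = b.
    by field.
  rewrite comb [LHS]xiE {}/u /a /= !tw expr0 expr1.
  by do 5 congr (_ + _); congr (_ *: _); field.
Qed.

Definition abs_continuous (a b : R) (f : R -> carnot R) : Prop :=
  forall e : R, 0 < e -> exists2 d : R, 0 < d &
    forall (n : nat) (l r : 'I_n -> R),
      (forall i, [/\ a <= l i, l i <= r i & r i <= b]) ->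
      trivIset setT (fun i => `]l i, r i[%classic) ->
      \sum_i (r i - l i) < d ->
      \sum_i `|f (r i) - f (l i)| < e.

(* A curve is a function on R of which only the values on [0, T] matter;
   its derivative is used almost everywhere on ]0, T[ only. *)
Definition connects p q (T : R) (x : R -> carnot R) : Prop :=
  [/\ 0 <= T, abs_continuous 0 T x, x 0 = p & x T = q].

Definition length (T : R) (x : R -> carnot R) : \bar R :=
  (\int[lebesgue_measure]_(t in `]0%R, T[%classic) (finsler (x t) (derive1 x t))%:E)%E.

Definition shortest p q (T : R) (x : R -> carnot R) : Prop :=
  connects p q T x /\
  forall (T' : R) (y : R -> carnot R),
    connects p q T' y -> (length T x <= length T' y)%E.

Definition natural (T : R) (x : R -> carnot R) : Prop :=
  {ae lebesgue_measure, forall t, `]0, T[%classic t -> finsler (x t) (derive1 x t) = 1}.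

Definition unique_shortest p q (T : R) (x : R -> carnot R) : Prop :=
  [/\ shortest p q T x, natural T x &
   forall (T' : R) (y : R -> carnot R), shortest p q T' y -> natural T' y ->
     T' = T /\ {in `[0, T], y =1 x}].

Definition is_control (T : R) (x : R -> carnot R) (u : vertex -> R -> R) : Prop :=
  [/\ forall v, measurable_fun `[0, T]%classic (u v),
      forall t, `[0, T]%classic t -> (forall v, 0 <= u v t) /\ \sum_v u v t = 1 &
      {ae lebesgue_measure, forall t, `]0, T[%classic t ->
         derive1 x t = \sum_v u v t *: vertex_at (x t) v}].

(* For a control, u v s = 1 means that the velocity is the vertex v. *)
Definition switches (T : R) (u : vertex -> R -> R) : set R :=
  [set t | `]0, T[%classic t /\ exists v w : vertex,
     [/\ v != w, \forall s \near t^'-, u v s = 1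
               & \forall s \near t^'+, u w s = 1]].

(* The control of a naturally parameterized curve is unique up to a null set,
   and changing it on a null set can only lose switches, whence "exists u". *)
Definition chattering (T : R) (x : R -> carnot R) : Prop :=
  exists2 u, is_control T x u &
    exists2 tau : R, `[0, T]%classic tau &
      forall e : R, 0 < e ->
        (switches T u `&` `]tau - e, tau + e[%classic #= [set: nat])%card.

End metric.

(* Main.v *)
Require Import Defs.
From HB Require Import structures.
From mathcomp Require Import all_boot all_order all_algebra.
From mathcomp Require Import all_classical all_reals all_analysis.
From mathcomp Require Import ring lra.

(** The problem of Fuller, to minimize the integral of z^2 for z'' = w with
    |w| <= 1 and given boundary values of z and z', is embedded in the group.

    The norm dominates the absolute value of the first component of the
    velocity, so no curve is shorter than the increase of x_1
    ([length_ge_crd1]). A curve from the origin with x_1(1) = 1 and length 1 is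
    therefore shortest. Along it the whole norm is spent on x_1, which forces
    [|x_2'| <= 1], x_3' = - x_2, x_4' = - x_3, x_5' = - x_1 x_3 and
    x_6' = x_3^2 / 2 ([finsler_unit]): the coordinate x_3 solves x_3'' = - x_2'
    and x_6 is half the cost of Fuller. If x_3 is the optimal trajectory X, the
    endpoint x_6(1) is minimal, and strict convexity of the cost leaves no
    other curve of length 1 with the same endpoints ([competitor_eq]).

    Optimality of X is certified by an adjoint function S with S^(4) = - w,
    S'' = X and w S >= 0, where w = x_2' = 1 or -1 is the control. Such an S is
    found in the self-similar form S(m t) = - m^4 S(t), with m the root of
    m^4 - 3 m^3 - 4 m^2 - 3 m + 1 in ]0, 1[. It keeps its sign between
    consecutive powers of m, with opposite signs on neighbouring intervals
    ([fuller_extremal_exists]). The control thus switches at every m^n with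
    n >= 1, and these times accumulate at the starting time 0
    ([extremal_chattering]).

    Competitors are merely absolutely continuous. What is needed about them is
    that they are differentiable almost everywhere and are the integrals of
    their derivatives ([ac_ftc]). An absolutely continuous function is a
    difference of two nondecreasing ones ([ac_jordan]); the Stieltjes measure
    of each of these is absolutely continuous with respect to the Lebesgue
    measure, so the theorems of Radon-Nikodym and of Lebesgue apply. All the
    later comparisons rest on one consequence: an absolutely continuous function
    increases by at most the integral of any nonnegative upper bound of its
    derivative ([ac_le_integral]), hence is nondecreasing if its derivative is
    nonnegative almost everywhere ([prim_le]). *)

Set Implicit Arguments.
Unset Strict Implicit.
Unset Printing Implicit Defensive.

Import Order.TTheory GRing.Theory Num.Theory.
Import numFieldNormedType.Exports.

Local Open Scope classical_set_scope.
Local Open Scope ring_scope.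

(** * Absolutely continuous real functions *)

Section absolute_continuity.
Variable R : realType.
Implicit Types (a b : R) (f : R -> R).

Definition itv_family a b (I : finType) (l r : I -> R) :=
  (forall i, [/\ a <= l i, l i <= r i & r i <= b]) /\
  trivIset setT (fun i => `]l i, r i[%classic).

(** Families are indexed by arbitrary finite types, because subdividing the
    intervals of a family gives a family indexed by pairs. *)
Definition ac a b f := forall e : R, 0 < e -> exists2 d : R, 0 < d &
  forall (I : finType) (l r : I -> R), itv_family a b l r ->
    \sum_i (r i - l i) < d -> \sum_i `|f (r i) - f (l i)| < e.

Lemma ordinal_ac a b f :
  (forall e : R, 0 < e -> exists2 d : R, 0 < d &
    forall (n : nat) (l r : 'I_n -> R), itv_family a b l r ->
      \sum_i (r i - l i) < d -> \sum_i `|f (r i) - f (l i)| < e) ->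
  ac a b f.
Proof.
move=> acf e /acf[d d0 {}acf]; exists d => // I l r [lr tlr] sd.
have ev (F : I -> R) : \sum_i F i = \sum_(j < #|I|) F (enum_val j).
  exact: (reindex _ (onW_bij _ (@enum_val_bij I))).
rewrite ev; apply: (acf _ (l \o enum_val) (r \o enum_val)); last by move: sd; rewrite ev.
split=> [i|]; first exact: lr.
apply/trivIsetP => i j _ _ ij; move/trivIsetP: tlr; apply => //.
by apply: contra ij => /eqP/enum_val_inj->.
Qed.

Lemma ac_uniform a b f e : ac a b f -> 0 < e -> exists2 d : R, 0 < d &
  forall s t, a <= s -> s <= t -> t <= b -> t - s < d -> `|f t - f s| < e.
Proof.
move=> acf /acf[d d0 {}acf]; exists d => // s t as_ st tb std.
have := @acf unit (fun=> s) (fun=> t); rewrite !big_const card_unit/= !addr0.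
by apply=> //; split=> //; apply/trivIsetP => -[] [] _ _ /eqP.
Qed.

Lemma ac_sub a b c d f : a <= c -> d <= b -> ac a b f -> ac c d f.
Proof.
move=> ac_ db acf e /acf[u u0 h]; exists u => // I l r [lr t]; apply: h.
by split=> // i; have [? ? ?] := lr i; split=> //; lra.
Qed.

Lemma ac_lip a b f k : (forall s t, a <= s -> s <= t -> t <= b ->
  `|f t - f s| <= k * (t - s)) -> ac a b f.
Proof.
move=> lip e e0; have k0 : 0 < `|k| + 1 by have := normr_ge0 k; lra.
exists (e / (`|k| + 1)); first by rewrite divr_gt0.
move=> I l r [lr _]; rewrite ltr_pdivlMr// mulrC mulr_sumr.
apply: le_lt_trans; apply: ler_sum => i _; have [? ? ?] := lr i.
apply: (le_trans (lip _ _ _ _ _)) => //.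
by apply: ler_wpM2r; [lra|have := ler_norm k; lra].
Qed.

Lemma acD a b f g : ac a b f -> ac a b g -> ac a b (f \+ g).
Proof.
move=> acf acg e e0; have e20 : 0 < e / 2 by rewrite divr_gt0.
have [u u0 hu] := acf _ e20; have [v v0 hv] := acg _ e20.
exists (Num.min u v) => [|I l r lr]; first by rewrite lt_min u0.
rewrite lt_min => /andP[/(hu _ _ _ lr) + /(hv _ _ _ lr)].
move=> h1 h2; rewrite [ltRHS]splitr; apply: le_lt_trans (ltrD h1 h2).
rewrite -big_split/=; apply: ler_sum => i _.
by rewrite opprD addrACA ler_normD.
Qed.

Lemma acZ a b f k : ac a b f -> ac a b (fun t => k * f t).
Proof.
move=> acf e e0; have k0 : 0 < `|k| + 1 by have := normr_ge0 k; lra.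
have [u u0 hu] := acf _ (divr_gt0 e0 k0); exists u => // I l r lr /(hu _ _ _ lr).
rewrite ltr_pdivlMr// mulrC mulr_sumr; apply: le_lt_trans.
apply: ler_sum => i _; rewrite -mulrBr normrM.
by apply: ler_wpM2r => //; lra.
Qed.

End absolute_continuity.

(** * Total variation and the Jordan decomposition *)

Section variation_of_ac.
Variable R : realType.
Implicit Types (a b : R) (f : R -> R).

(** Reading past the end of a partition returns the right endpoint, so
    partitions of different sizes can be read as monotone sequences of a common
    length; the extra intervals are empty. *)
Lemma itv_partition_nth_homo a b (s : seq R) : itv_partition a b s ->
  {homo (fun j => nth b (a :: s) j) : j k / (j <= k)%N >-> j <= k}.
Proof.
move=> [/(pathP b) abs /eqP lsb]; apply/nondecreasing_seqP => j /=.
have [js|] := ltnP j (size s); first exact/ltW/abs.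
rewrite leq_eqVlt => /predU1P[<-|sj].
  by rewrite (nth_default _ (leqnn _)) -[X in _ <= X]lsb -last_nth.
by rewrite !nth_default//= ltnW.
Qed.

Lemma itv_partition_nth_itv a b (s : seq R) j : itv_partition a b s ->
  a <= nth b (a :: s) j <= b.
Proof.
move=> abs; have h := itv_partition_nth_homo abs.
rewrite (h 0%N j)//=; have [js|sj] := leqP (size (a :: s)) j.
  by rewrite nth_default.
rewrite -[leRHS](@nth_default _ b (a :: s) (size s).+1)//.
by apply: h; exact: ltnW.
Qed.

Lemma variation_ord a b f (s : seq R) m : (size s <= m)%N -> itv_partition a b s ->
  variation a b f s =
  \sum_(j < m) `|f (nth b (a :: s) j.+1) - f (nth b (a :: s) j)|.
Proof.
move=> sm [_ /eqP lsb].
rewrite /variation -(big_mkord xpredT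
  (fun j => `|f (nth b (a :: s) j.+1) - f (nth b (a :: s) j)|)).
rewrite [RHS](big_cat_nat (n := size s))//= [X in _ + X]big_nat_cond.
rewrite [X in _ + X]big1 ?addr0// => j; rewrite andbT => /andP[sj _].
rewrite (nth_default _ sj); move: sj; rewrite leq_eqVlt => /predU1P[<-|sj].
  by rewrite -last_nth lsb subrr normr0.
by rewrite nth_default ?subrr ?normr0.
Qed.

(** Subdividing the intervals of a family produces a family of the same total
    length, so absolute continuity controls the variation over the family. *)
Lemma ac_variation a b f e : ac a b f -> 0 < e -> exists2 d : R, 0 < d &
  forall (I : finType) (l r : I -> R), itv_family a b l r ->
    \sum_i (r i - l i) < d ->
  forall s : I -> seq R, (forall i, itv_partition (l i) (r i) (s i)) ->
    \sum_i variation (l i) (r i) f (s i) < e.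
Proof.
move=> acf /acf[d d0 {}acf]; exists d => // I l r [lr tlr] rld s ps.
(* all partitions are padded to the size of the largest *)
pose m := (\max_i size (s i))%N.
have sm i : (size (s i) <= m)%N by exact: (leq_bigmax i).
pose p i j := nth (r i) (l i :: s i) j.
pose l' (x : I * 'I_m) := p x.1 x.2; pose r' (x : I * 'I_m) := p x.1 x.2.+1.
have -> : \sum_i variation (l i) (r i) f (s i) = \sum_x `|f (r' x) - f (l' x)|.
  rewrite -(pair_bigA _ (fun i j => `|f (r' (i, j)) - f (l' (i, j))|))/=.
  by apply: eq_bigr => i _; exact: variation_ord.
apply: acf.
  split=> [[i j]|].
    have [al lri rb] := lr i; rewrite /l' /r' /=; split.
    - by have /andP[+ _] := itv_partition_nth_itv j (ps i); exact: le_trans.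
    - exact: itv_partition_nth_homo.
    - by have /andP[_ /le_trans->] := itv_partition_nth_itv j.+1 (ps i).
  apply/trivIsetP => -[i j] [i' j'] _ _; rewrite xpair_eqE.
  have [->|ii'] := eqVneq i i' => /= jj'; last first.
    move/trivIsetP: tlr => /(_ i i' Logic.I Logic.I ii') dis.
    apply: (subsetI_eq0 _ _ dis) => z; rewrite /l' /r' /= !in_itv/= => /andP[z1 z2].
      have /andP[h1 _] := itv_partition_nth_itv j (ps i).
      have /andP[_ h2] := itv_partition_nth_itv j.+1 (ps i).
      by rewrite (le_lt_trans h1)// (lt_le_trans z2).
    have /andP[h1 _] := itv_partition_nth_itv j' (ps i').
    have /andP[_ h2] := itv_partition_nth_itv j'.+1 (ps i').
    by rewrite (le_lt_trans h1)// (lt_le_trans z2).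
  wlog: j j' jj' / (j < j')%N.
    by move=> h; case: (ltngtP j j') jj' => [*|*|/ord_inj->];
      [exact: h|rewrite setIC h// eq_sym|rewrite eqxx].
  move=> {}jj'; apply/seteqP; split=> // z [] /=.
  rewrite /l' /r' !in_itv/= => /andP[_ z1] /andP[z2 _].
  have := itv_partition_nth_homo (ps i') jj'.
  by move=> /(lt_le_trans z1) /lt_trans /(_ z2); rewrite ltxx.
rewrite -(pair_bigA _ (fun i j => r' (i, j) - l' (i, j)))/=.
rewrite (eq_bigr (fun i => r i - l i))// => i _.
rewrite -(big_mkord xpredT (fun j => p i j.+1 - p i j)) telescope_sumr//=.
congr (_ - _); rewrite /p; have := sm i; rewrite leq_eqVlt => /predU1P[<-|?].
  by rewrite -last_nth; have [_ /eqP] := ps i.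
by rewrite nth_default.
Qed.

(** An interval can be crossed in finitely many steps, over each of which the
    variation is at most 1. *)
Lemma ac_total_variation_lty a b f c : ac a b f -> a <= c -> c <= b ->
  (total_variation a c f < +oo)%E.
Proof.
move=> acf; have [d d0 hd] := ac_variation acf ltr01.
have small s t : a <= s -> s <= t -> t <= b -> t - s < d ->
    (total_variation s t f < +oo)%E.
  move=> as_ st tb std; apply: (@le_lt_trans _ _ 1%:E); last exact: ltry.
  apply: ub_ereal_sup => _ [_ [u pu <-] <-]; rewrite lee_fin; apply: ltW.
  have := hd unit (fun=> s) (fun=> t) _ _ (fun=> u).
  rewrite !big_const card_unit/= !addr0; apply => //.
  by split=> //; apply/trivIsetP => -[] [] _ _ /eqP.
have d20 : 0 < d / 2 by rewrite divr_gt0.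
suff H n t : a <= t -> t <= b -> t - a <= n%:R * (d / 2) ->
    (total_variation a t f < +oo)%E.
  move=> ac_ cb; apply: (H (Num.bound ((c - a) / (d / 2)))) => //.
  rewrite -ler_pdivrMr//; apply/ltW/archi_boundP.
  by apply: divr_ge0; lra.
elim: n t => [|n IH] t ta tb.
  by rewrite mul0r => h; (have -> : t = a by lra); rewrite total_variationxx.
rewrite -addn1 natrD mulrDl mul1r => h.
pose s := Num.max a (t - d / 2).
have sE : (s = a /\ t - d / 2 <= a) \/ (s = t - d / 2 /\ a <= t - d / 2).
  by rewrite /s; case: (leP a (t - d / 2)) => ?; [right|left; split=> //; lra].
have sa : a <= s by lra.
rewrite (@total_variationD _ _ _ s)//; last lra.
apply: lte_add_pinfty; last by apply: small; lra.
case: sE => -[-> ?]; first by apply: small; lra.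
by apply: IH; lra.
Qed.

Let V a f t := fine (total_variation a t f).

Lemma ac_tv_fine a b f s t : ac a b f -> a <= s -> s <= t -> t <= b ->
  (V a f t - V a f s)%:E = total_variation s t f.
Proof.
move=> acf as_ st tb; rewrite /V (@total_variationD _ _ _ s)//.
have h1 : total_variation a s f \is a fin_num.
  by rewrite ge0_fin_numE ?total_variation_ge0// (ac_total_variation_lty acf)//; lra.
have acs : ac s b f by exact: ac_sub acf.
have h2 : total_variation s t f \is a fin_num.
  by rewrite ge0_fin_numE ?total_variation_ge0// (ac_total_variation_lty acs).
by rewrite fineD// addrAC subrr add0r fineK.
Qed.

(** Variations over the members of a family are approximated from below by
    partitions, to which [ac_variation] applies. *)
Lemma ac_tv a b f : ac a b f -> ac a b (V a f).
Proof.
move=> acf e e0; have e20 : 0 < e / 2 by rewrite divr_gt0.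
have [d d0 hd] := ac_variation acf e20; exists d => // I l r lr rld.
(* the approximation errors add up to at most e / 2; the 1 covers an empty I *)
pose k := e / 2 / (#|I|%:R + 1).
have k0 : 0 < k by rewrite divr_gt0// ltr_wpDl.
have exs i : exists s : seq R, itv_partition (l i) (r i) s /\
    `|V a f (r i) - V a f (l i)| <= variation (l i) (r i) f s + k.
  have [al lri rb] := lr.1 i; have tvE := ac_tv_fine acf al lri rb.
  have fin : ereal_sup [set x%:E | x in variations (l i) (r i) f] \is a fin_num.
    by rewrite -[ereal_sup _]/(total_variation _ _ f) -tvE.
  have [_ [_ [s ps <-] <-]] := ub_ereal_sup_adherent k0 fin.
  rewrite -[ereal_sup _]/(total_variation _ _ f) -tvE -EFinB lte_fin => h.
  exists s; split=> //; rewrite ger0_norm; first lra.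
  by rewrite -lee_fin tvE total_variation_ge0.
have {exs}[s /all_and2[ps hs]] := choice exs.
have := hd _ _ _ lr rld _ ps.
move=> h; apply: (le_lt_trans (ler_sum _ (fun i _ => hs i))).
rewrite big_split/= sumr_const [ltRHS]splitr ltr_leD//.
rewrite -[leLHS]mulr_natr /k mulrAC ler_pdivrMr ?ltr_wpDl//.
by rewrite ler_pM2l// lerDl.
Qed.

Lemma ac_dist_tv a b f s t : ac a b f -> a <= s -> s <= t -> t <= b ->
  `|f t - f s| <= V a f t - V a f s.
Proof.
move=> acf as_ st tb.
by rewrite -lee_fin (ac_tv_fine acf)// total_variation_ge.
Qed.

(** The decomposition of Jordan: the variation of an absolutely continuous
    function is absolutely continuous, hence so are both monotone parts. *)
Lemma ac_jordan a b f : ac a b f -> exists g h : R -> R,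
  [/\ ac a b g, ac a b h, {in `[a, b] &, {homo g : s t / s <= t}},
      {in `[a, b] &, {homo h : s t / s <= t}} & f = g \- h].
Proof.
move=> acf; exists (V a f), (V a f \- f).
have acV := ac_tv acf.
have acN : ac a b (fun t => -1 * f t) by exact: acZ.
have VD s t : s \in `[a, b] -> t \in `[a, b] -> s <= t ->
    `|f t - f s| <= V a f t - V a f s.
  by rewrite !in_itv/= => /andP[? _] /andP[_ ?] ?; exact: ac_dist_tv acf _ _ _.
split=> //.
- rewrite (_ : _ \- f = V a f \+ (fun t => -1 * f t)); first exact: acD.
  by apply/funext => t /=; rewrite mulN1r.
- move=> s t sab tab st; have := VD _ _ sab tab st.
  by have := normr_ge0 (f t - f s); lra.
- move=> s t sab tab st /=; have := VD _ _ sab tab st.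
  by have := ler_norm (f t - f s); lra.
- by apply/funext => t /=; lra.
Qed.

Lemma ac_bounded a b f : a <= b -> ac a b f ->
  exists2 M, 0 < M & forall t, a <= t -> t <= b -> `|f t| <= M.
Proof.
move=> ab acf; have Vab := ac_dist_tv acf (lexx a) ab (lexx b).
exists (`|f a| + (V a f b - V a f a) + 1) => [|t at_ tb].
  by have := normr_ge0 (f a); have := normr_ge0 (f b - f a); lra.
have := ac_dist_tv acf (lexx a) at_ tb; have := ac_dist_tv acf at_ tb (lexx b).
have := normr_ge0 (f b - f t); have := ler_normD (f t - f a) (f a).
by rewrite subrK; lra.
Qed.

Lemma acM a b f g : a <= b -> ac a b f -> ac a b g -> ac a b (f \* g).
Proof.
move=> ab acf acg; have [M M0 fM] := ac_bounded ab acf.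
have [N N0 gN] := ac_bounded ab acg => e e0.
have acNf : ac a b (fun t => N * f t) by exact: acZ.
have acMg : ac a b (fun t => M * g t) by exact: acZ.
have e20 : 0 < e / 2 by rewrite divr_gt0.
have [u u0 hu] := acNf _ e20; have [v v0 hv] := acMg _ e20.
exists (Num.min u v) => [|I l r lr]; first by rewrite lt_min u0.
rewrite lt_min => /andP[/(hu _ _ _ lr) + /(hv _ _ _ lr)].
move=> h1 h2; rewrite [ltRHS]splitr; apply: le_lt_trans (ltrD h1 h2).
rewrite -big_split/=; apply: ler_sum => i _; have [? ? ?] := lr.1 i.
have -> : f (r i) * g (r i) - f (l i) * g (l i) =
  g (r i) * (f (r i) - f (l i)) + f (l i) * (g (r i) - g (l i)) by ring.
rewrite -!mulrBr (le_trans (ler_normD _ _))// !normrM.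
rewrite (gtr0_norm M0) (gtr0_norm N0) lerD// ler_wpM2r//.
  by apply: gN; lra.
by apply: fM; lra.
Qed.

End variation_of_ac.

(** * The fundamental theorem of calculus for absolutely continuous functions *)

Section stieltjes.
Variable R : realType.
Implicit Types (a b : R) (f : R -> R).
Let lambda : measure _ _ := @lebesgue_measure R.

Definition clip a b (t : R) := Num.max a (Num.min b t).

Lemma clip_cases a b t : a <= b -> [\/ clip a b t = a /\ t <= a,
  clip a b t = t /\ a <= t <= b | clip a b t = b /\ b <= t].
Proof.
move=> ab; rewrite /clip; have [bt|tb] := leP b t.
  by constructor 3; rewrite (max_idPr ab).
have [at_|ta] := leP a t; first by constructor 2; split=> //; lra.
by constructor 1; split=> //; exact: ltW.
Qed.

Lemma clip_itv a b t : a <= b -> a <= clip a b t <= b.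
Proof. by move=> ab; have [] := clip_cases t ab => -[-> ?]; lra. Qed.

Lemma clip_id a b t : a <= t <= b -> clip a b t = t.
Proof.
by move=> tab; (have ab : a <= b by lra); have [] := clip_cases t ab => -[-> ?]; lra.
Qed.

Lemma clip_le a b : a <= b -> {homo clip a b : s t / s <= t}.
Proof.
by move=> ab s t st; have [] := clip_cases s ab => -[-> ?];
  have [] := clip_cases t ab => -[-> ?]; lra.
Qed.

Lemma clip_lip a b s t : a <= b -> s <= t -> clip a b t - clip a b s <= t - s.
Proof.
by move=> ab st; have [] := clip_cases s ab => -[-> ?];
  have [] := clip_cases t ab => -[-> ?]; lra.
Qed.

Lemma clip_itvS a b s t : a <= b ->
  `]clip a b s, clip a b t[%classic `<=` `]s, t[%classic.
Proof.
move=> ab z /=; rewrite !in_itv/=.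
by have [] := clip_cases s ab => -[-> ?];
  have [] := clip_cases t ab => -[-> ?]; lra.
Qed.

(** A function on [a, b] extends to the line by constants, as a Stieltjes measure
    requires, and stays absolutely continuous on every interval. *)
Lemma ac_clip a b c d f : a <= b -> ac a b f -> ac c d (f \o clip a b).
Proof.
move=> ab acf e /acf[u u0 h]; exists u => // I l r [lr tlr] rld.
apply: (h I (clip a b \o l) (clip a b \o r)).
  split=> [i|].
    have /andP[? _] := clip_itv (l i) ab; have /andP[_ ?] := clip_itv (r i) ab.
    by split=> //; apply: clip_le => //; have [] := lr i.
  apply/trivIsetP => i j _ _ ij; move/trivIsetP: tlr => /(_ _ _ Logic.I Logic.I ij).
  by move=> dis; apply: (subsetI_eq0 _ _ dis); exact: (clip_itvS ab).
apply: le_lt_trans rld; apply: ler_sum => i _ /=.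
by apply: clip_lip => //; have [] := lr i.
Qed.

Lemma bounded_open_interval a b (J : set R) : a <= b -> open J ->
  is_interval J -> J `<=` `]a, b[%classic ->
  exists lr : R * R,
    [/\ a <= lr.1, lr.1 <= lr.2, lr.2 <= b & J = `]lr.1, lr.2[%classic].
Proof.
move=> ab oJ iJ Jab; have [->|J0] := eqVneq J set0.
  by exists (a, a); split=> //=; rewrite set_itvoo0.
move/set0P: J0 => J0.
have lJ : has_lbound J by exists a => z /Jab /=; rewrite in_itv/= => /andP[/ltW].
have uJ : has_ubound J by exists b => z /Jab /=; rewrite in_itv/= => /andP[_ /ltW].
exists (inf J, sup J) => /=; split.
- by apply: lb_le_inf => // z /Jab /=; rewrite in_itv/= => /andP[/ltW].
- have [z Jz] := J0; apply: (@le_trans _ _ z); first exact: ge_inf.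
  exact: ub_le_sup.
- by apply: ge_sup => // z /Jab /=; rewrite in_itv/= => /andP[_ /ltW].
- by rewrite -[LHS]((interior_id J).1 oJ) interval_bounded_interior// set_itvE.
Qed.

Section nondecreasing.
Variables (a b : R) (f : R -> R).
Hypothesis (ab : a < b) (acf : forall c d, ac c d f).
Hypothesis (ndf : {homo f : s t / s <= t}).

Let rcf : right_continuous f.
Proof.
apply/right_continuousW => x; apply/cvgrPdist_lt => e e0.
have [d d0 hd] := ac_uniform (acf (x - 1) (x + 1)) e0.
near=> y.
have : `|x - y| < Num.min d 1.
  by near: y; apply: (@nbhsx_ballx _ R^o); rewrite lt_min d0 ltr01.
rewrite lt_min => /andP[h1 h2]; rewrite !ltr_distl in h1 h2.
by have [xy|yx] := leP x y; [rewrite distrC|]; apply: hd; lra.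
Unshelve. all: by end_near. Qed.

Let F : cumulative R R := HB.pack f (isCumulative.Build R _ R f ndf rcf).
Let mu : measure _ _ := lebesgue_stieltjes_measure F.

Let mu_oc s t : s <= t -> mu `]s, t]%classic = (f t - f s)%:E.
Proof.
move=> st; rewrite /mu/= /lebesgue_stieltjes_measure /measure_extension.
by rewrite measurable_mu_extE/= ?wlength_itv_bnd//; exact: is_ocitv.
Qed.

(** Outer regularity puts a Lebesgue null set inside a small open set, which is
    a disjoint union of open intervals, and absolute continuity bounds the total
    increase of f over any finitely many of them. *)
Let mu_null A : measurable A -> lambda A = 0%E -> mu (A `&` `]a, b]) = 0%E.
Proof.
have ab11 : a - 1 <= b + 1 by have := ab; lra.
move=> mA A0; apply/eqP; rewrite eq_le measure_ge0 andbT.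
apply/lee_addgt0Pr => e e0; rewrite add0e.
have [d d0 hd] := acf (a - 1) (b + 1) e0.
have Aoo : (lambda A < +oo)%E by rewrite A0.
have [U [oU AU UAd]] := lebesgue_regularity_outer mA Aoo d0.
have Ud : (lambda U < d%:E)%E.
  have mU : measurable U by exact: measurable_realfun.open_measurable.
  rewrite (measureDI lambda mU mA) setIidr//.
  by rewrite [X in (_ + X)%E]A0 adde0.
have [I [oI tI UI]] := OpenSetDisjointItvs.open_disjoint_itv oU.
(* the intervals I q may be unbounded; only their parts near [a, b] matter *)
pose J q := I q `&` `]a - 1, b + 1[%classic.
have oJ q : open (J q) by apply: openI; [exact: (oI q).1|exact: itv_open].
have iJ q : is_interval (J q).
  move=> x y [Ix abx] [Iy aby] z xzy; split; first exact: ((oI q).2 x y Ix Iy z xzy).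
  move: xzy abx aby; rewrite /= !in_itv/= => /andP[xz zy] /andP[ax _] /andP[_ yb].
  by rewrite (lt_le_trans ax xz) (le_lt_trans zy yb).
have [lr /all_and4[al le_lr rb JE]] :=
  choice (fun q => bounded_open_interval ab11 (oJ q) (iJ q) (@subIsetr _ _ _)).
have mJ q : measurable (J q) by exact: measurable_realfun.open_measurable.
have tJ : trivIset setT J.
  apply/trivIsetP => i j _ _ ij; move/trivIsetP: tI => /(_ _ _ Logic.I Logic.I ij).
  by move=> dis; apply: (subsetI_eq0 _ _ dis) => z [].
have AJ : A `&` `]a, b] `<=` \bigcup_q J q.
  move=> z [/AU]; rewrite UI => -[q _ Iz]; rewrite /= in_itv/= => zab.
  by exists q => //; split=> //=; rewrite in_itv/=; lra.
apply: (@le_trans _ _ (mu (\bigcup_q J q))).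
  apply: le_measure => //; rewrite inE; first by apply: measurableI.
  exact: bigcupT_measurable.
rewrite measure_semi_bigcup//; last exact: bigcupT_measurable.
apply: lime_le; first exact: is_cvg_nneseries.
apply: nearW => n; rewrite big_mkord.
apply: (@le_trans _ _ (\sum_(i < n) (f (lr i).2 - f (lr i).1))%:E).
  rewrite -sumEFin; apply: lee_sum => i _; rewrite -mu_oc//.
  apply: le_measure => [||z]; [rewrite inE; exact: mJ|rewrite inE; exact: measurable_itv|].
  by rewrite JE /= !in_itv/= => /andP[-> /ltW].
rewrite lee_fin; apply/ltW.
have := hd 'I_n (fun i => (lr i).1) (fun i => (lr i).2).
under [X in (_ -> _ -> X < _) -> _]eq_bigr do rewrite ger0_norm ?subr_ge0 ?ndf//.
apply.
  split=> [i|]; first by split.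
  apply/trivIsetP => i j _ _ ij; rewrite -!JE.
  by move/trivIsetP: tJ; exact.
rewrite -lte_fin -sumEFin; apply: le_lt_trans Ud.
rewrite (eq_bigr (fun i : 'I_n => lambda (J i))); last first.
  move=> i _; rewrite JE [RHS]lebesgue_measure_itv/= lte_fin; case: ltP => // ?.
  by congr EFin; apply/eqP; rewrite subr_eq0 eq_le le_lr andbT.
rewrite -measure_bigsetU//; apply: le_measure; rewrite ?inE.
- by apply: bigsetU_measurable => i _; exact: mJ.
- exact: measurable_realfun.open_measurable.
- by rewrite UI => z; rewrite -bigcup_mkord => -[q _ [Iz _]]; exists q.
Qed.

(** The density is the Radon-Nikodym derivative of the Stieltjes measure of f,
    restricted to ]a, b] to make it finite. *)
Lemma nondecreasing_ac_density : exists g : R -> R,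
  lambda.-integrable setT (EFin \o g) /\
  forall x, a <= x <= b -> f x - f a = \int[lambda]_(t in `]a, x]) g t.
Proof.
have mD : measurable (`]a, b]%classic : set (measurableTypeR R)) by [].
have muD : (mu `]a, b]%classic < +oo)%E by rewrite mu_oc ?ltry// ltW.
pose nu : {finite_measure set (measurableTypeR R) -> \bar R} := mfrestr mD muD.
have nul : nu `<< lambda by apply/null_content_dominatesP => A mA /(mu_null mA).
have [g [_ gfin ig gE]] := radon_nikodym_sigma_finite nul.
exists (fine \o g); split.
  by rewrite (_ : _ \o _ = g)//; apply/funext => x /=; rewrite fineK.
move=> x /andP[ax xb]; rewrite /Rintegral (eq_integral g); last first.
  by move=> t _; rewrite /= fineK.
rewrite -gE// /nu/= /mfrestr /mrestr -[mu _ as X in X]/(mu _) setIidl ?mu_oc//.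
by move=> z; rewrite /= !in_itv/= => /andP[-> /le_trans->].
Qed.

End nondecreasing.

(** Both halves of the fundamental theorem, the second by the Lebesgue
    differentiation theorem. *)
Lemma ac_ftc a b f : a < b -> ac a b f -> exists g : R -> R,
  [/\ lambda.-integrable setT (EFin \o g),
      forall x, a <= x <= b -> f x - f a = \int[lambda]_(t in `]a, x]) g t &
      {ae lambda, forall t, `]a, b[%classic t -> is_derive t 1 f (g t)}].
Proof.
move=> ab /ac_jordan[p [q [acp acq ndp ndq ->]]] {f}.
have nd (h : R -> R) : {in `[a, b] &, {homo h : s t / s <= t}} ->
    {homo (h \o clip a b) : s t / s <= t}.
  move=> ndh s t st.
  by apply: ndh; [rewrite in_itv; exact/clip_itv/ltW..|exact: (clip_le (ltW ab))].
have [u [iu uE]] := nondecreasing_ac_density ab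
  (fun c d => ac_clip c d (ltW ab) acp) (nd _ ndp).
have [v [iv vE]] := nondecreasing_ac_density ab
  (fun c d => ac_clip c d (ltW ab) acq) (nd _ ndq).
pose g x := u x - v x.
have ig : lambda.-integrable setT (EFin \o g).
  rewrite (_ : _ \o _ = (EFin \o u) \- (EFin \o v))%E; first exact: integrableB.
  by apply/funext => x /=; rewrite EFinB.
have gE x : a <= x <= b ->
    (p \- q) x - (p \- q) a = \int[lambda]_(t in `]a, x]) g t.
  move=> axb; rewrite RintegralB//; [|exact: integrableS iu|exact: integrableS iv].
  have aab : a <= a <= b by rewrite lexx ltW.
  by have := uE _ axb; have := vE _ axb; rewrite /= !clip_id// => <- <-; ring.
exists g; split=> //.
have iy y : lambda.-integrable [set` Interval (BRight a) (BRight y)] (EFin \o g).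
  exact: integrableS ig.
have lg : locally_integrable setT g.
  by apply: open_integrable_locally => //; exact: openT.
have := FTC1 iy lg.
apply: filterS; first exact: (ae_filter_ringOfSetsType lambda).
move=> t h; rewrite /= in_itv/= => /andP[at_ tb].
have [|dF F'] := h; first exact: at_.
have dF1 : is_derive t 1 (fun s => \int[lambda]_(x in `]a, s]) g x) (g t).
  by apply: DeriveDef; [exact: dF|rewrite -derive1E; exact: F'].
have dF2 : is_derive t 1
    (fun s => \int[lambda]_(x in `]a, s]) g x + (p \- q) a) (g t).
  have := is_deriveD dF1 (is_derive_cst ((p \- q) a) t 1).
  by rewrite addr0.
apply: near_eq_is_derive dF2; near=> s; rewrite -gE ?subrK//.
suff : s \in `]a, b[ by rewrite in_itv/= => /andP[/ltW-> /ltW].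
by near: s; apply: near_in_itvoo; rewrite in_itv/= at_ tb.
Unshelve. all: by end_near. Qed.

End stieltjes.

(** * Functions with a given derivative almost everywhere *)

#[global] Instance ae_lebesgue_filter (R : realType) :
  Filter (nbhs (almost_everywhere (@lebesgue_measure R))).
Proof. exact: ae_filter_ringOfSetsType. Qed.

Section ae_comparison.
Import HBNNSimple.

(** The integral of a nonnegative function is a supremum over the simple
    functions below it, and such a simple function can be set to 0 on a null
    set. The length of a curve integrates an expression in the derivative of an
    arbitrary curve, whose measurability is then never in question. *)
Lemma nonmeasurable_ae_ge0_le_integral d (T : measurableType d) (R : realType)
    (mu : {measure set T -> \bar R}) (D : set T) (f g : T -> \bar R) :
  measurable D -> (forall x, D x -> 0 <= f x)%E -> (forall x, D x -> 0 <= g x)%E ->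
  {ae mu, forall x, D x -> (f x <= g x)%E} ->
  (\int[mu]_(x in D) f x <= \int[mu]_(x in D) g x)%E.
Proof.
move=> mD f0 g0 [N [mN N0 fgN]]; rewrite !ge0_integralE//.
apply: ub_ereal_sup => _ [h hf <-].
have mCN := measurableC mN; pose k := proj_nnsfun h mCN.
have kE x : k x = (h \_ (~` N)) x by rewrite (mrestrict h mCN).
apply: ereal_sup_ubound; exists k => [x|].
  rewrite kE [in leLHS]patchE; have [xN|xN] := boolP (x \in ~` N); last first.
    by rewrite patchE; case: ifPn => // xD; apply: g0; rewrite inE in xD.
  apply: (le_trans (hf x)); rewrite !patchE; case: ifPn => // xD.
  apply: contrapT => fgx; rewrite inE in xN; apply: xN; apply: fgN => /= H.
  by apply: fgx; apply: H; rewrite inE in xD.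
rewrite -!integralT_nnsfun; apply: ae_eq_integral => //.
- exact/measurable_realfun.measurable_EFinP.
- exact/measurable_realfun.measurable_EFinP.
exists N; split=> // x /= H; apply: contrapT => xN; apply: H => _.
by have := kE x; rewrite patchE mem_set//= => ->.
Qed.

End ae_comparison.

Section primitives.
Variable R : realType.
Implicit Types (a b : R) (f g : R -> R).

Lemma ac_le_integral a b f g (phi : R -> \bar R) : a < b -> ac a b f ->
  {ae lebesgue_measure, forall t, `]a, b[%classic t -> is_derive t 1 f (g t)} ->
  (forall t, `]a, b[%classic t -> 0 <= phi t)%E ->
  {ae lebesgue_measure, forall t, `]a, b[%classic t -> ((g t)%:E <= phi t)%E} ->
  ((f b - f a)%:E <=
     \int[lebesgue_measure]_(t in `]a, b[%classic) phi t)%E.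
Proof.
move=> ab acf df phi0 gphi; have [h [ih hE dh]] := ac_ftc ab acf.
have iab : lebesgue_measure.-integrable `]a, b[%classic (EFin \o h).
  exact: integrableS ih.
have mh := measurable_int _ iab.
rewrite (hE b) ?lexx ?(ltW ab)// -Rintegral_itv_bndo_bndc//.
rewrite /Rintegral fineK; last exact: integrable_fin_num.
apply: (@le_trans _ _ (\int[lebesgue_measure]_(t in `]a, b[%classic) (EFin \o h)^\+ t)%E).
  apply: le_integral => //; first exact: integrable_funepos.
  by move=> t _; rewrite funeposE le_max lexx.
apply: nonmeasurable_ae_ge0_le_integral => //.
move: df dh gphi; apply: filterS3 => t df dh gphi tab.
rewrite funeposE /= ge_max phi0// andbT.
have [_ <-] := dh tab; have [_ ->] := df tab; exact: gphi.
Qed.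

(** The name stands for primitive: by [prim_uniq], g determines f up to a
    constant. *)
Definition prim a b f g := ac a b f /\
  {ae lebesgue_measure, forall t, `]a, b[%classic t -> is_derive t 1 f (g t)}.

Lemma prim_sub a b c d f g : a <= c -> d <= b -> prim a b f g -> prim c d f g.
Proof.
move=> ac_ db [acf df]; split; first exact: ac_sub acf.
move: df; apply: filterS => t h tcd; apply: h; move: tcd.
by rewrite /= !in_itv/= => /andP[h1 h2]; rewrite (le_lt_trans ac_ h1) (lt_le_trans h2 db).
Qed.

Lemma prim_ae_eq a b f g h :
  {ae lebesgue_measure, forall t, `]a, b[%classic t -> g t = h t} ->
  prim a b f g -> prim a b f h.
Proof.
move=> gh [acf df]; split=> //; move: gh df; apply: filterS2 => t gh df tab.
by rewrite -gh//; exact: df.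
Qed.

Lemma prim_eq a b f g h : (forall t, a < t < b -> g t = h t) ->
  prim a b f g -> prim a b f h.
Proof.
by move=> gh; apply: prim_ae_eq; apply: nearW => t; rewrite /= in_itv/= => /gh.
Qed.

Lemma primD a b f g df dg : prim a b f df -> prim a b g dg ->
  prim a b (f \+ g) (df \+ dg).
Proof.
move=> [acf hf] [acg hg]; split; first exact: acD.
move: hf hg; apply: filterS2 => t hf hg tab.
by have := is_deriveD (hf tab) (hg tab).
Qed.

Lemma primZ a b f df k : prim a b f df ->
  prim a b (fun t => k * f t) (fun t => k * df t).
Proof.
move=> [acf hf]; split; first exact: acZ.
by move: hf; apply: filterS => t hf tab; have := is_deriveZ k (hf tab).
Qed.

Lemma primB a b f g df dg : prim a b f df -> prim a b g dg ->
  prim a b (f \- g) (df \- dg).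
Proof.
move=> hf /(primZ (-1)) /(primD hf).
by congr prim; apply/funext => t /=; rewrite mulN1r.
Qed.

Lemma primM a b f g df dg : a <= b -> prim a b f df -> prim a b g dg ->
  prim a b (f \* g) (fun t => f t * dg t + g t * df t).
Proof.
move=> ab [acf hf] [acg hg]; split; first exact: acM.
by move: hf hg; apply: filterS2 => t hf hg tab; have := is_deriveM (hf tab) (hg tab).
Qed.

(** Absolute continuity excludes the opposite of a Cantor staircase, which has
    derivative 0 almost everywhere and yet decreases. *)
Lemma prim_le a b f df : a <= b -> prim a b f df ->
  {ae lebesgue_measure, forall t, `]a, b[%classic t -> 0 <= df t} -> f a <= f b.
Proof.
rewrite le_eqVlt => /predU1P[->//|ab] /(primZ (-1))[acf hf] df0.
have := ac_le_integral (phi := cst 0%E) ab acf hf (fun _ _ => lexx _).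
rewrite integral0 lee_fin !mulN1r opprK addrC subr_le0; apply.
by move: df0; apply: filterS => t h /h; rewrite mulN1r lee_fin oppr_le0.
Qed.

Lemma prim_nondecreasing a b f df s t : prim a b f df ->
  {ae lebesgue_measure, forall t, `]a, b[%classic t -> 0 <= df t} ->
  a <= s -> s <= t -> t <= b -> f s <= f t.
Proof.
move=> pf df0 as_ st tb; apply: prim_le st (prim_sub as_ tb pf) _.
move: df0; apply: filterS => u h tcd; apply: h; move: tcd.
by rewrite /= !in_itv/= => /andP[h1 h2]; rewrite (le_lt_trans as_ h1) (lt_le_trans h2 tb).
Qed.

Lemma prim0_cst a b f t : prim a b f (cst 0) -> a <= t <= b -> f t = f a.
Proof.
move=> pf /andP[at_ tb]; apply/eqP; rewrite eq_le; apply/andP; split.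
  have := @prim_nondecreasing a b _ _ a t (primZ (-1) pf) _ (lexx a) at_ tb.
  rewrite !mulN1r lerN2; apply; apply: nearW => u _ /=.
  by rewrite mulr0.
by apply: (@prim_nondecreasing a b f _ a t) => //; [exact: pf|exact: nearW].
Qed.

Lemma prim_uniq a b f g df t : prim a b f df -> prim a b g df -> f a = g a ->
  a <= t <= b -> f t = g t.
Proof.
move=> pf pg fg atb; have := primB pf pg.
move/(prim_eq (h := cst 0)) => /(_ _) /prim0_cst-/(_ t) /= H.
apply/eqP; rewrite -subr_eq0 H ?fg ?subrr// => u _; exact: subrr.
Qed.

Lemma prim_derive_eq a b f g df dg : (forall t, a <= t <= b -> f t = g t) ->
  prim a b f df -> prim a b g dg ->
  {ae lebesgue_measure, forall t, `]a, b[%classic t -> df t = dg t}.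
Proof.
move=> fg [_ hf] [_ hg]; move: hf hg; apply: filterS2 => t hf hg tab.
have [_ <-] := hf tab; have [_ <-] := hg tab; apply: near_eq_derive.
near=> s; apply: fg; suff : s \in `]a, b[ by rewrite in_itv/= => /andP[/ltW-> /ltW].
by near: s; exact: near_in_itvoo.
Unshelve. all: by end_near. Qed.

Lemma prim_cst a b (k : R) : prim a b (fun=> k) (cst 0).
Proof.
split; first by apply: (@ac_lip _ _ _ _ 0) => s t _ _ _; rewrite subrr normr0 mul0r.
by apply: nearW => t _; exact: is_derive_cst.
Qed.

Lemma prim_id a b : prim a b id (cst (1 : R)).
Proof.
split.
  apply: (@ac_lip _ _ _ _ 1) => s t _ st _.
  by rewrite mul1r ger0_norm ?subr_ge0.
by apply: nearW => t _; exact: is_derive_id.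
Qed.

(** The square of f has derivative 2 f f', which vanishes almost everywhere. *)
Lemma prim_ae0 a b f df : prim a b f df -> f a = 0 ->
  {ae lebesgue_measure, forall t, `]a, b[%classic t -> f t = 0} ->
  forall t, a <= t <= b -> f t = 0.
Proof.
move=> pf fa f0 t tab; have ab : a <= b by case/andP: tab; exact: le_trans.
have pff : prim a b (f \* f) (cst 0).
  apply: prim_ae_eq (primM ab pf pf); move: f0; apply: filterS => s fs0 sab.
  by rewrite /= fs0// mul0r addr0.
have := prim0_cst pff tab; rewrite /= fa mul0r => /eqP.
by rewrite mulf_eq0 orbb => /eqP.
Qed.

(** The form in which optimality is turned into uniqueness: a monotone quantity
    with equal end values cannot vary, and its derivative must vanish. *)
Lemma prim_monotone_loop a b f df : prim a b f df -> f b = f a ->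
  {ae lebesgue_measure, forall t, `]a, b[%classic t -> 0 <= df t} ->
  (forall t, a <= t <= b -> f t = f a) /\
  {ae lebesgue_measure, forall t, `]a, b[%classic t -> df t = 0}.
Proof.
move=> pf fab df0; have cst_f t : a <= t <= b -> f t = f a.
  move=> /andP[at_ tb]; apply/eqP; rewrite eq_le.
  rewrite (prim_nondecreasing pf df0 (lexx a) at_ tb) andbT -fab.
  exact: (prim_nondecreasing pf df0 at_ tb (lexx b)).
by split=> //; apply: prim_derive_eq cst_f pf (prim_cst a b (f a)).
Qed.

End primitives.

(** * Curves in the group and their length *)

Section curves.
Variable R : realType.
Implicit Types (p q v xi : carnot R) (T : R) (y : R -> carnot R).

Lemma ler_crd_norm v k : `|v@_k| <= `|v|.
Proof.
rewrite /crd [leRHS]mx_normrE.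
exact: (le_bigmax 0 (fun ij : 'I_1 * 'I_6 => `|v ij.1 ij.2|) (ord0, inord k.-1)).
Qed.

Lemma crd_norm_le v (c : R) : 0 <= c ->
  (forall k, (0 < k <= 6)%N -> `|v@_k| <= c) -> `|v| <= c.
Proof.
move=> c0 vc; rewrite [leLHS]mx_normrE; apply: bigmax_le => // -[i j] _ /=.
have := vc j.+1 (ltn_ord j); rewrite /crd /= inord_val.
by rewrite (_ : i = ord0)//; apply/val_inj; case: i => -[].
Qed.

Lemma crdB (u v : carnot R) k : (u - v)@_k = u@_k - v@_k.
Proof. by rewrite /crd !mxE. Qed.

Lemma crd_ac T y k : abs_continuous 0 T y -> ac 0 T (fun t => (y t)@_k).
Proof.
move=> acy; apply: ordinal_ac => e e0; have [d d0 h] := acy e e0; exists d => // n l r [lr tlr] rd.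
apply: le_lt_trans (h _ _ _ lr tlr rd); apply: ler_sum => i _.
by rewrite -crdB ler_crd_norm.
Qed.

Lemma lipschitz_abs_continuous T y : (forall k s t, (0 < k <= 6)%N ->
    0 <= s -> s <= t -> t <= T -> `|(y t)@_k - (y s)@_k| <= t - s) ->
  abs_continuous 0 T y.
Proof.
move=> lip e e0; exists e => // n l r lr _; apply: le_lt_trans.
apply: ler_sum => i _; have [? ? ?] := lr i.
apply: crd_norm_le => [|k k6]; first by rewrite subr_ge0.
by rewrite crdB; exact: lip.
Qed.

Lemma is_derive_crd y (t : R) xi k : is_derive t 1 y xi ->
  is_derive t 1 (fun s => (y s)@_k) xi@_k.
Proof.
case=> dy <-; apply: DeriveDef; first exact: (derivable_mxP _ _ _).1.
by rewrite /crd derive_mx// mxE.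
Qed.

Lemma crd_is_derive y (t : R) xi :
  (forall k, (0 < k <= 6)%N -> is_derive t 1 (fun s => (y s)@_k) xi@_k) ->
  is_derive t 1 y xi.
Proof.
move=> dk; have dj (j : 'I_6) : is_derive t 1 (fun s => y s ord0 j) (xi ord0 j).
  by have := dk j.+1 (ltn_ord j); rewrite /crd/= inord_val.
have dy : derivable y t 1.
  by apply/derivable_mxP => i j; rewrite ord1; case: (dj j).
apply: DeriveDef => //; apply/rowP => j; rewrite derive_mx// mxE.
by case: (dj j).
Qed.

(** Each of the six coordinates is differentiable almost everywhere, hence so is
    the curve, and its derivative is the vector of theirs. *)
Lemma crd_prim T y k : 0 < T -> abs_continuous 0 T y ->
  prim 0 T (fun t => (y t)@_k) (fun t => (derive1 y t)@_k).
Proof.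
move=> T0 acy; split; first exact: crd_ac.
have dj (j : 'I_6) : {ae lebesgue_measure, forall t, `]0, T[%classic t ->
    derivable (fun s => y s ord0 j) t 1}.
  have [h [_ _ dh]] := ac_ftc T0 (crd_ac j.+1 acy).
  move: dh; apply: filterS => t h' /h'[+ _].
  by rewrite /crd /= inord_val.
move: (filter_forall (ae_lebesgue_filter R) dj); apply: filterS => t dt t0T.
apply: is_derive_crd; rewrite derive1E; apply: DeriveDef => //.
by apply/derivable_mxP => i j; rewrite ord1; exact: dt.
Qed.

Lemma finsler_crd1 v xi : `|xi@_1| <= finsler v xi.
Proof. by rewrite /finsler -!addrA ler_wpDr ?le_max ?lexx// !addr_ge0. Qed.

Lemma finsler_ge0 v xi : 0 <= finsler v xi.
Proof. exact: le_trans (finsler_crd1 v xi). Qed.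

Lemma length_ge0 T y : (0 <= length T y)%E.
Proof. by apply: integral_ge0 => t _; rewrite lee_fin finsler_ge0. Qed.

(** The first coordinate is a calibration: no curve is shorter than the
    increase of its first coordinate. *)
Lemma length_ge_crd1 p q T y : connects p q T y ->
  ((q@_1 - p@_1)%:E <= length T y)%E.
Proof.
move=> [+ acy <- <-]; rewrite le_eqVlt => /predU1P[<-|T0].
  by rewrite subrr length_ge0.
have [ac1 d1] := crd_prim 1 T0 acy.
apply: ac_le_integral T0 ac1 d1 _ _ => [t _|]; first by rewrite lee_fin finsler_ge0.
apply: nearW => t _; rewrite lee_fin; apply: le_trans (ler_norm _) _.
exact: finsler_crd1.
Qed.

Lemma length_natural T y : 0 <= T -> natural T y -> length T y = T%:E.
Proof.
move=> T0 nat.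
have -> : T%:E = (\int[lebesgue_measure]_(t in `]0%R, T[%classic) (cst 1%E) t)%E.
  rewrite integral_cst// mul1e [RHS]lebesgue_measure_itv/= lte_fin.
  by case: ltgtP T0 => // [_|<-] _; rewrite ?oppr0 ?adde0.
apply/eqP; rewrite eq_le; apply/andP; split;
  apply: nonmeasurable_ae_ge0_le_integral => //; try by
    move=> t _; rewrite lee_fin finsler_ge0.
  all: by move: nat; apply: filterS => t h /h ->.
Qed.

End curves.

(** * Iterated primitives of a bounded function *)

Section bounded_primitive.
Variable R : realType.
Implicit Types (f F : R -> R).

Definition lip1 F := forall s t : R, `|F t - F s| <= `|t - s|.

Lemma lip1_continuous F : lip1 F -> continuous F.
Proof.
move=> lF x; apply/cvgrPdist_lt => e e0; near=> y.
apply: le_lt_trans (lF _ _) _.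
by near: y; apply: (@nbhsx_ballx _ R^o).
Unshelve. all: by end_near. Qed.

Lemma lip1_le F :
  (forall s t, s <= t -> `|F t - F s| <= t - s) -> lip1 F.
Proof.
move=> h s t; have [st|/ltW ts] := leP s t.
  by rewrite (ger0_norm (x := t - s)) ?subr_ge0//; exact: h.
by rewrite distrC (ler0_norm (x := t - s)) ?subr_le0// opprB; exact: h.
Qed.

Lemma lip1_clip : lip1 (clip 0 1 : R -> R).
Proof.
apply: lip1_le => s t st; rewrite ger0_norm ?subr_ge0; first exact: clip_lip.
exact: (clip_le ler01).
Qed.

(** Cutting the integral off outside [0, 1] makes the primitive Lipschitz and
    bounded on the whole line, so that primitives can be iterated. *)
Lemma bounded_primitive_exists f : measurable_fun setT f ->
  (forall t, `|f t| <= 1) ->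
  exists F, [/\ F 0 = 0, lip1 F, (forall t, `|F t| <= 1) &
    forall t, 0 < t < 1 -> {for t, continuous f} -> is_derive t 1 F (f t)].
Proof.
move=> mf f1.
pose P t := \int[lebesgue_measure]_(s in `]0, t]) f s.
have i1 a b : lebesgue_measure.-integrable `]a, b]%classic (EFin \o cst (1 : R)).
  rewrite (_ : EFin \o _ = cst 1%E)//.
  apply/integrableP; split=> //; under eq_integral do rewrite /= normr1.
  rewrite integral_cst// mul1e [ltLHS]lebesgue_measure_itv/=.
  by case: ifP => // _; rewrite -EFinB ltry.
have if_ a b : lebesgue_measure.-integrable `]a, b]%classic (EFin \o f).
  apply: (le_integrable _ _ _ (i1 a b)) => //.
    by apply/measurable_realfun.measurable_EFinP; exact: measurable_funS mf.
  by move=> t _ /=; rewrite lee_fin normr1.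
have P0 : P 0 = 0 by rewrite /P set_itvoc0 Rintegral_set0.
have lP s t : 0 <= s -> s <= t -> `|P t - P s| <= t - s.
  move=> s0 st; rewrite /P Rintegral_itvB ?bnd_simp//.
  apply: le_trans (le_normr_Rintegral _ _) _ => //.
  have -> : t - s = \int[lebesgue_measure]_(u in `]s, t]) (cst 1) u.
    have mst : lebesgue_measure (`]s, t]%classic : set R) = (t - s)%:E.
      rewrite lebesgue_measure_itv/= lte_fin.
      by case: ltgtP st => // -> _; rewrite subrr.
    by rewrite Rintegral_cst// mul1r; exact: (esym (congr1 fine mst)).
  apply: le_Rintegral => //; first by have := integrable_norm (if_ s t).
exists (P \o clip 0 1); split.
- by rewrite /= clip_id// lexx ler01.
- apply: lip1_le => s t st /=; have c01 := clip_itv s (@ler01 R).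
  apply: (le_trans (lP _ _ _ _)); first by case/andP: c01.
    exact: (clip_le (@ler01 R)).
  exact: (clip_lip (@ler01 R)).
- move=> t /=; have /andP[c0 c1] := clip_itv t (@ler01 R).
  by have := lP 0 _ (lexx 0) c0; rewrite P0 !subr0 => /le_trans; apply.
- move=> t /andP[t0 t1] ct.
  have [dP P'] : derivable P t 1 /\ P^`()%classic t = f t.
    exact: (@continuous_FTC1 R f (BRight 0) t 1 t1 (if_ 0 1) t0 ct).
  have dt : is_derive t 1 P (f t).
    by apply: DeriveDef; [exact: dP|rewrite -derive1E; exact: P'].
  apply: near_eq_is_derive dt; near=> s; rewrite /= clip_id//.
  suff : s \in `]0, 1[ by rewrite in_itv/= => /andP[/ltW-> /ltW].
  by near: s; apply: near_in_itvoo; rewrite in_itv/= t0 t1.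
Unshelve. all: by end_near. Qed.

End bounded_primitive.

(** * The ratio of consecutive switching times *)

Section ratio.
Variable R : realType.

(** The root is near 0.2421. Both bounds are only as sharp as
    [fuller_quartic_ge0] demands. *)
Lemma fuller_ratio_exists : exists m : R, 1 / 5 <= m <= 8 / 33 /\
  m ^+ 4 - 3 * m ^+ 3 - 4 * m ^+ 2 - 3 * m + 1 = 0.
Proof.
pose p : {poly R} := 'X^4 - 3%:P * 'X^3 - 4%:P * 'X^2 - 3%:P * 'X + 1.
have pE x : p.[x] = x ^+ 4 - 3 * x ^+ 3 - 4 * x ^+ 2 - 3 * x + 1.
  by rewrite /p !hornerE.
have [] := @IVT R (fun x => p.[x]) (1 / 5) (8 / 33) 0.
- lra.
- by apply: continuous_subspaceT; exact: continuous_horner.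
- rewrite !pE ge_min le_max; apply/andP; split; apply/orP; [right|left]; lra.
- by move=> m; rewrite in_itv/= pE => mI m0; exists m.
Qed.

End ratio.

(** * The self-similar bang-bang control *)

Section phases.
Variables (R : realType) (m : R).
Hypotheses (m_gt0 : 0 < m) (m_lt1 : m < 1).
Implicit Types (n k : nat) (t : R) (f F : R -> R).

Lemma expr_gap n k : (n < k)%N -> m ^+ k <= m ^+ n.+1.
Proof. by move=> nk; rewrite ler_wiXn2l// ltW. Qed.

Lemma phase_uniq n k t : m ^+ n.+1 <= t < m ^+ n -> m ^+ k.+1 <= t < m ^+ k ->
  n = k.
Proof.
move=> /andP[n1 n2] /andP[k1 k2]; have [nk|kn|//] := ltngtP n k.
  by have := lt_le_trans k2 (expr_gap nk); rewrite ltNge n1.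
by have := lt_le_trans n2 (expr_gap kn); rewrite ltNge k1.
Qed.

Lemma expr_small t : 0 < t -> exists n, m ^+ n < t.
Proof.
move=> t0; have : `|m| < 1 by rewrite gtr0_norm.
move=> /cvg_expr/cvgrPdist_lt/(_ _ t0)[N _ /(_ N (leqnn N))].
by rewrite /= sub0r normrN gtr0_norm ?exprn_gt0//; exists N.
Qed.

Lemma phase_exists t : 0 < t < 1 -> exists n, m ^+ n.+1 <= t < m ^+ n.
Proof.
move=> /andP[t0 t1]; have [N Nt] := expr_small t0.
have ex : exists n, m ^+ n <= t by exists N; exact: ltW.
case: (ex_minnP ex) => -[|n] nt nmin; first by move: nt t1; rewrite expr0 leNgt => /negP.
exists n; rewrite nt ltNge; apply/negP => /nmin; by rewrite ltnn.
Qed.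

(** The phases [m^(n+1), m^n[ accumulate at 0; the control is -1 on those of odd
    index n and 1 on the others. *)
Definition negative_phases : set R :=
  \bigcup_n `[m ^+ n.*2.+2, m ^+ n.*2.+1[%classic.

Definition bang t : bool := `[< negative_phases t >].

Lemma bangE n t : m ^+ n.+1 <= t < m ^+ n -> bang t = odd n.
Proof.
move=> tn; apply/asboolP/idP => [[k _]|on].
  by rewrite /= in_itv/= => /(phase_uniq tn) ->; rewrite /= odd_double.
exists n./2 => //=; rewrite in_itv/=.
by move: (odd_double_half n); rewrite on add1n => ->.
Qed.

Lemma bang_scale t : 0 < t < 1 -> bang (m * t) = ~~ bang t.
Proof.
move=> /phase_exists[n tn]; rewrite (bangE tn) (@bangE n.+1)//.
by rewrite !(exprS _ n.+1) !(exprS _ n) ler_pM2l// ltr_pM2l// -exprS.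
Qed.

Definition bang_sign t : R := (-1) ^+ bang t.

Lemma measurable_negative_phases : measurable negative_phases.
Proof. by apply: bigcupT_measurable => n; exact: measurable_itv. Qed.

Lemma bang_signE t : bang_sign t = 1 - 2 * \1_negative_phases t.
Proof.
rewrite /bang_sign /bang indicE; case: asboolP => h.
  by rewrite mem_set// expr1 mulr1; lra.
by rewrite memNset// expr0 mulr0; lra.
Qed.

Lemma measurable_bang_sign : measurable_fun setT bang_sign.
Proof.
rewrite (_ : bang_sign = fun t => 1 - 2 * \1_negative_phases t); last first.
  by apply/funext => t; rewrite bang_signE.
apply: measurable_realfun.measurable_funB => //.
apply: measurable_realfun.measurable_funM => //.
apply: measurable_realfun.measurable_indic.
exact: measurable_negative_phases.
Qed.

Lemma near_phase n t : m ^+ n.+1 < t < m ^+ n ->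
  \forall s \near t, m ^+ n.+1 <= s < m ^+ n.
Proof.
move=> tn; near=> s; suff : s \in `]m ^+ n.+1, m ^+ n[.
  by rewrite in_itv/= => /andP[/ltW-> ->].
by near: s; apply: near_in_itvoo; rewrite in_itv.
Unshelve. all: by end_near. Qed.

Lemma bang_sign_continuous n t : m ^+ n.+1 < t < m ^+ n ->
  {for t, continuous bang_sign}.
Proof.
move=> tn; apply/cvgrPdist_lt => e e0; near=> s.
rewrite /bang_sign (@bangE n s); last by near: s; exact: near_phase.
rewrite (@bangE n t) ?subrr ?normr0//.
by move/andP: (tn) => [/ltW-> ->].
Unshelve. all: by end_near. Qed.

Lemma phase_unit n t : m ^+ n.+1 < t < m ^+ n -> 0 < t < 1.
Proof.
move=> /andP[t1 t2]; rewrite (lt_trans _ t1) ?exprn_gt0//.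
by apply: lt_le_trans t2 _; rewrite exprn_ile1// ltW.
Qed.

Lemma ae_phase (P : R -> Prop) :
  (forall n t, m ^+ n.+1 < t < m ^+ n -> P t) ->
  {ae lebesgue_measure, forall t, `]0, 1[%classic t -> P t}.
Proof.
move=> nP; exists (range (fun n => m ^+ n)); split.
- by apply: countable_measurable => [t|]; [exact: measurable_set1|exact: card_image_le].
- by apply: countable_lebesgue_measure0; exact: card_image_le.
move=> t /= H; apply: contrapT => tm; apply: H; rewrite in_itv/= => t01.
have [n /andP[n1 n2]] := phase_exists t01; apply: (nP n); rewrite n2 andbT.
by rewrite lt_neqAle n1 andbT; apply/eqP => E; apply: tm; exists n.+1.
Qed.

(** Weaker than differentiability on ]0, 1[: at the powers of m the control
    jumps and its primitive has a corner. *)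
Definition phase_prim F f := [/\ F 0 = 0, lip1 F &
  forall n t, m ^+ n.+1 < t < m ^+ n -> is_derive t 1 F (f t)].

Lemma phase_prim_prim F f : phase_prim F f -> prim 0 1 F f.
Proof.
move=> [_ lF dF]; split; last exact: ae_phase.
apply: (@ac_lip _ _ _ _ 1) => s t _ st _.
by rewrite mul1r -[leRHS]ger0_norm ?subr_ge0.
Qed.

(** A primitive vanishing at 0 inherits the self-similarity of its derivative,
    with one more factor m. *)
Lemma phase_prim_scale c F f : phase_prim F f ->
  (forall t, 0 < t < 1 -> f (m * t) = c * f t) ->
  forall t, 0 <= t <= 1 -> F (m * t) = m * c * F t.
Proof.
move=> pF fc t t01; have [F0 lF dF] := pF.
have pFm : prim 0 1 (fun t => F (m * t)) (fun t => m * c * f t).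
  split.
    apply: (@ac_lip _ _ _ _ 1) => s u _ su _; rewrite mul1r.
    apply: (le_trans (lF _ _)); rewrite -mulrBr normrM gtr0_norm//.
    by rewrite ger0_norm ?subr_ge0// ler_piMl ?subr_ge0// ltW.
  apply: ae_phase => n u un.
  have dm : is_derive u 1 (fun t => m * t) m.
    by apply: is_derive_eq; rewrite /GRing.scale /= mulr1.
  have := is_derive1_comp (dF n.+1 (m * u) _) dm.
  rewrite fc; last exact: phase_unit un.
  have -> : m * c * f u = c * f u * m by ring.
  apply.
  by rewrite !(exprS _ n.+1) !(exprS _ n) !ltr_pM2l// -exprS.
have := prim_uniq pFm (primZ (m * c) (phase_prim_prim pF)) _ t01; apply.
by rewrite mulr0 F0 mulr0.
Qed.

(** On the phase of index 0 the control is constant, so its iterated primitives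
    are polynomials. They are expressed through their values at 1, which
    self-similarity then determines. *)
Lemma phase0_explicit F f p : phase_prim F f -> continuous p ->
  (forall t, m < t < 1 -> is_derive t 1 p (f t)) ->
  forall t, m <= t <= 1 -> F t = F 1 + (p t - p 1).
Proof.
move=> [_ lF dF] cp dp t /andP[mt]; rewrite le_eqVlt => /predU1P[->|t1].
  by rewrite subrr addr0.
have d0 x : x \in `]t, 1[ -> is_derive x 1 (F - p) 0.
  rewrite in_itv/= => /andP[tx x1]; have mx := le_lt_trans mt tx.
  have := is_deriveB (@dF 0%N x _) (dp x _).
  by rewrite subrr expr1 expr0 mx x1; apply.
have [|c _] := MVT t1 d0.
  apply: continuous_subspaceT => x.
  by apply: continuousB; [exact: lip1_continuous|exact: cp].
rewrite mul0r => /eqP; rewrite subr_eq0 => /eqP; rewrite !fctE => E.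
by have := E; lra.
Qed.

Lemma near_left_phase n : \forall s \near (m ^+ n)^'-, m ^+ n.+1 <= s < m ^+ n.
Proof.
near=> s; apply/andP; split; last by near: s; exact: nbhs_left_lt.
near: s; apply: nbhs_left_ge; rewrite exprS gtr_pMl ?exprn_gt0//.
Unshelve. all: by end_near. Qed.

Lemma near_right_phase n :
  \forall s \near (m ^+ n.+1)^'+, m ^+ n.+1 <= s < m ^+ n.
Proof.
near=> s; apply/andP; split; first by apply: ltW; near: s; exact: nbhs_right_gt.
near: s; apply: nbhs_right_lt; rewrite exprS gtr_pMl ?exprn_gt0//.
Unshelve. all: by end_near. Qed.

End phases.

(** * The extremal of the problem of Fuller *)

Section fuller_algebra.
Variable R : realType.
Implicit Types m h x y a b r : R.

(** The hypotheses are the values at t = m, namely r = h, of the four polynomials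
    in r = 1 - t that describe the iterated primitives on [m, 1], each equated
    with its self-similar rescaling; y, x, a, b are the values at t = 1.
    Eliminating y, x and a shows that a positive multiple of b equals
    h^4 (m^2 - 1) times the quartic polynomial of which m is a root. So b = 0: the adjoint function
    vanishes at 1, hence at all switching times. *)
Lemma fuller_amplitude0 m h y x a b : 0 < m < 1 -> h = 1 - m ->
  m ^+ 4 - 3 * m ^+ 3 - 4 * m ^+ 2 - 3 * m + 1 = 0 ->
  y - h = - m * y ->
  x + y * h - h ^+ 2 / 2 = - m ^+ 2 * x ->
  a - x * h - y * h ^+ 2 / 2 + h ^+ 3 / 6 = - m ^+ 3 * a ->
  b - a * h + x * h ^+ 2 / 2 + y * h ^+ 3 / 6 - h ^+ 4 / 24 = - m ^+ 4 * b ->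
  [/\ y * (1 + m) = h, 2 * x * ((1 + m) * (1 + m ^+ 2)) = - h ^+ 3 & b = 0].
Proof.
move=> /andP[m0 m1] hE root e1 e2 e3 e4.
have f1 : y * (1 + m) = h by lra.
have f2 : 2 * x * ((1 + m) * (1 + m ^+ 2)) = - h ^+ 3.
  transitivity ((1 + m) * h ^+ 2 - 2 * h * (y * (1 + m))).
    rewrite (_ : 2 * x * _ = 2 * (1 + m) * (x - (- m ^+ 2 * x))); last ring.
    by rewrite -e2; field.
  by rewrite f1 hE; ring.
split=> //.
pose D := (1 + m ^+ 4) * (1 + m ^+ 3) * 24 * (1 + m) * (1 + m ^+ 2).
have : D * b = 0.
  have g3 : a * (1 + m ^+ 3) = x * h + y * h ^+ 2 / 2 - h ^+ 3 / 6 by lra.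
  have g4 : b * (1 + m ^+ 4) = a * h - x * h ^+ 2 / 2 - y * h ^+ 3 / 6 + h ^+ 4 / 24.
    by lra.
  rewrite /D.
  transitivity ((1 + m) * (1 + m ^+ 2) * 24 *
    (a * (1 + m ^+ 3) * h - (1 + m ^+ 3) * (x * h ^+ 2 / 2 + y * h ^+ 3 / 6 - h ^+ 4 / 24))).
    rewrite (_ : _ * b = (1 + m) * (1 + m ^+ 2) * 24 * ((1 + m ^+ 3) * (b * (1 + m ^+ 4)))).
      by rewrite g4; ring.
    by ring.
  rewrite g3.
  transitivity (6 * h ^+ 2 * (1 - m ^+ 3) * (2 * x * ((1 + m) * (1 + m ^+ 2)))
    + 4 * h ^+ 3 * (2 - m ^+ 3) * (1 + m ^+ 2) * (y * (1 + m))
    - h ^+ 4 * (3 - m ^+ 3) * ((1 + m) * (1 + m ^+ 2))); first by field.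
  rewrite f1 f2.
  transitivity (h ^+ 4 * (m ^+ 2 - 1) *
    (m ^+ 4 - 3 * m ^+ 3 - 4 * m ^+ 2 - 3 * m + 1)); first by rewrite hE; ring.
  by rewrite root mulr0.
have D0 : D != 0.
  have p k : 0 < 1 + m ^+ k by have := exprn_gt0 k m0; lra.
  have p2 := p 2%N; have p3 := p 3%N; have p4 := p 4%N.
  by rewrite /D gt_eqF// !mulr_gt0//; lra.
by move=> /eqP; rewrite mulf_eq0 (negbTE D0) => /eqP.
Qed.

(** The quartic vanishes at both ends r = 0 and r = h of a phase, the latter by
    the hypothesis on a; the remaining quadratic factor Q decreases on [0, h]
    and is positive at h. *)
Lemma fuller_quartic_ge0 m h y x a r : 1 / 5 <= m <= 8 / 33 ->
  h = 1 - m -> y * (1 + m) = h ->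
  2 * x * ((1 + m) * (1 + m ^+ 2)) = - h ^+ 3 ->
  a * h = x * h ^+ 2 / 2 + y * h ^+ 3 / 6 - h ^+ 4 / 24 ->
  0 <= r <= h ->
  0 <= - (a * r) + x * r ^+ 2 / 2 + y * r ^+ 3 / 6 - r ^+ 4 / 24.
Proof.
move=> /andP[m1 m2] hE f1 f2 f4 /andP[r0 rh].
have h0 : 0 < h by lra.
have aE : a = x * h / 2 + y * h ^+ 2 / 6 - h ^+ 3 / 24.
  have h_neq0 : h != 0 by rewrite gt_eqF.
  by apply: (mulIf h_neq0); rewrite f4; field.
pose Q := r ^+ 2 + r * h + h ^+ 2 - 4 * y * (r + h) - 12 * x.
have -> : - (a * r) + x * r ^+ 2 / 2 + y * r ^+ 3 / 6 - r ^+ 4 / 24 =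
  r * (h - r) / 24 * Q by rewrite aE /Q; field.
apply: mulr_ge0; first by rewrite !mulr_ge0 ?subr_ge0// invr_ge0.
have QE : Q = (h - r) * (4 * y - r - 2 * h) + (3 * h ^+ 2 - 8 * y * h - 12 * x).
  by rewrite /Q; ring.
rewrite QE addr_ge0//.
  apply: mulr_ge0; first lra.
  suff : 3 * h <= 4 * y by lra.
  have : 3 * h * (1 + m) <= 4 * y * (1 + m).
    by rewrite -(mulrA 4) f1 -subr_ge0 (_ : _ - _ = h * (1 - 3 * m)); [rewrite mulr_ge0//; lra|ring].
  by rewrite ler_pM2r//; lra.
have D0 : 0 < (1 + m) * (1 + m ^+ 2).
  by rewrite mulr_gt0//; [lra|have := sqr_ge0 m; lra].
rewrite -(pmulr_lge0 _ D0).
have -> : (3 * h ^+ 2 - 8 * y * h - 12 * x) * ((1 + m) * (1 + m ^+ 2)) =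
    h ^+ 2 * (3 * m ^+ 3 - 5 * m ^+ 2 - 3 * m + 1).
  transitivity (3 * h ^+ 2 * ((1 + m) * (1 + m ^+ 2)) - 8 * h * (1 + m ^+ 2) * (y * (1 + m))
     - 6 * (2 * x * ((1 + m) * (1 + m ^+ 2)))); first by ring.
  by rewrite f1 f2 hE; ring.
rewrite mulr_ge0 ?sqr_ge0//.
(* at r = h, Q is a positive multiple of this cubic, which is positive for m
   up to about 0.246 *)
have m2sq : m ^+ 2 <= (8 / 33) ^+ 2 by rewrite ler_pXn2r// nnegrE; lra.
have m3 : (1 / 5) ^+ 3 <= m ^+ 3 by rewrite ler_pXn2r// nnegrE; lra.
lra.
Qed.

End fuller_algebra.

Section fuller_extremal.
Variables (R : realType) (m : R).
Hypothesis m_bounds : 1 / 5 <= m <= 8 / 33.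
Hypothesis m_root : m ^+ 4 - 3 * m ^+ 3 - 4 * m ^+ 2 - 3 * m + 1 = 0.

Let m_gt0 : 0 < m. Proof. by move: m_bounds; lra. Qed.
Let m_lt1 : m < 1. Proof. by move: m_bounds; lra. Qed.

Lemma phase_prim_exists (f : R -> R) : measurable_fun setT f ->
  (forall t, `|f t| <= 1) ->
  (forall n t, m ^+ n.+1 < t < m ^+ n -> {for t, continuous f}) ->
  exists F, phase_prim m F f /\ forall t, `|F t| <= 1.
Proof.
move=> mf f1 cf; have [F [F0 lF F1 dF]] := bounded_primitive_exists mf f1.
exists F; split=> //; split=> // n t tn.
by apply: dF; [exact: (phase_unit m_gt0 m_lt1 tn)|exact: cf tn].
Qed.

Lemma continuous_phase_prim_exists (f : R -> R) : continuous f ->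
  (forall t, `|f t| <= 1) ->
  exists F, phase_prim m F f /\ forall t, `|F t| <= 1.
Proof.
move=> cf f1; apply: phase_prim_exists => // [|n t _]; last exact: cf.
exact: measurable_realfun.continuous_measurable_fun.
Qed.

(** Integrating the control four times from 0, with one change of sign, gives a
    function S satisfying the maximum principle of Pontryagin: the control is the
    sign of S. By self-similarity the sign has to be checked on one phase only. *)
Lemma fuller_extremal_exists : exists Y X P S : R -> R,
  [/\ phase_prim m Y (bang_sign m), phase_prim m X (fun t => - Y t),
      phase_prim m P X, phase_prim m S P &
      [/\ forall t, `|Y t| <= 1, forall t, `|X t| <= 1 &
          forall t, 0 < t < 1 -> 0 <= bang_sign m t * S t]].
Proof.
have w1 t : `|bang_sign m t| <= 1 by rewrite /bang_sign normrX normrN1 expr1n.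
have [Y [pY Y1]] := phase_prim_exists (measurable_bang_sign m) w1
  (@bang_sign_continuous _ _ m_gt0 m_lt1).
have cY : continuous Y by apply: lip1_continuous; case: pY.
have [||X [pX X1]] := @continuous_phase_prim_exists (fun t => - Y t).
- by move=> t; apply: cvgN; exact: cY.
- by move=> t; rewrite normrN.
have cX : continuous X by apply: lip1_continuous; case: pX.
have [P [pP P1]] := continuous_phase_prim_exists cX X1.
have cP : continuous P by apply: lip1_continuous; case: pP.
have [S [pS S1]] := continuous_phase_prim_exists cP P1.
exists Y, X, P, S; split=> //; split=> //.
have le01 (t : R) : 0 < t < 1 -> 0 <= t <= 1 by lra.
have sY t : 0 <= t <= 1 -> Y (m * t) = m * (-1) * Y t.
  apply: (phase_prim_scale m_gt0 m_lt1 pY) => u u01.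
  by rewrite /bang_sign bang_scale// mulN1r; case: bang; rewrite /= ?expr1 ?expr0 ?opprK.
have sX t : 0 <= t <= 1 -> X (m * t) = m * (m * (-1)) * X t.
  by apply: (phase_prim_scale m_gt0 m_lt1 pX) => u /le01/sY E; rewrite /= E [RHS]mulrN.
have sP t : 0 <= t <= 1 -> P (m * t) = m * (m * (m * (-1))) * P t.
  by apply: (phase_prim_scale m_gt0 m_lt1 pP) => u /le01/sX.
have sS t : 0 <= t <= 1 -> S (m * t) = m * (m * (m * (m * (-1)))) * S t.
  by apply: (phase_prim_scale m_gt0 m_lt1 pS) => u /le01/sP.
have YE t : m <= t <= 1 -> Y t = Y 1 - (1 - t).
  move=> tm; rewrite (phase0_explicit pY (p := id) _ _ tm).
  - by rewrite opprB.
  - by move=> z; exact: cvg_id.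
  - move=> z zm; rewrite /bang_sign (@bangE _ m m_gt0 m_lt1 0%N).
      by rewrite /= expr0; exact: is_derive_id.
    by rewrite expr0 expr1; lra.
have poly_cont (p dp : R -> R) : (forall t : R, is_derive t 1 p (dp t)) -> continuous p.
  by move=> dp' t; apply/differentiable_continuous/derivable1_diffP; case: (dp' t).
have XE t : m <= t <= 1 -> X t = X 1 + Y 1 * (1 - t) - (1 - t) ^+ 2 / 2.
  pose p (t : R) := Y 1 * (1 - t) - (1 - t) ^+ 2 / 2.
  have dp (s : R) : is_derive s 1 p (- (Y 1 - (1 - s))).
    by rewrite /p; apply: is_derive_eq; rewrite /GRing.scale /=; field.
  move=> tm; rewrite (phase0_explicit pX (poly_cont _ _ dp) _ tm).
    by rewrite /p; field.
  by move=> s sm; rewrite YE//; lra.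
have PE t : m <= t <= 1 ->
    P t = P 1 - X 1 * (1 - t) - Y 1 * (1 - t) ^+ 2 / 2 + (1 - t) ^+ 3 / 6.
  pose p (t : R) := - (X 1 * (1 - t)) - Y 1 * (1 - t) ^+ 2 / 2 + (1 - t) ^+ 3 / 6.
  have dp (s : R) : is_derive s 1 p (X 1 + Y 1 * (1 - s) - (1 - s) ^+ 2 / 2).
    by rewrite /p; apply: is_derive_eq; rewrite /GRing.scale /=; field.
  move=> tm; rewrite (phase0_explicit pP (poly_cont _ _ dp) _ tm).
    by rewrite /p; field.
  by move=> s sm; rewrite XE//; lra.
have SE t : m <= t <= 1 -> S t = S 1 - P 1 * (1 - t) + X 1 * (1 - t) ^+ 2 / 2
    + Y 1 * (1 - t) ^+ 3 / 6 - (1 - t) ^+ 4 / 24.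
  pose p (t : R) := - (P 1 * (1 - t)) + X 1 * (1 - t) ^+ 2 / 2
    + Y 1 * (1 - t) ^+ 3 / 6 - (1 - t) ^+ 4 / 24.
  have dp (s : R) : is_derive s 1 p
      (P 1 - X 1 * (1 - s) - Y 1 * (1 - s) ^+ 2 / 2 + (1 - s) ^+ 3 / 6).
    by rewrite /p; apply: is_derive_eq; rewrite /GRing.scale /=; field.
  move=> tm; rewrite (phase0_explicit pS (poly_cont _ _ dp) _ tm).
    by rewrite /p; field.
  by move=> s sm; rewrite PE//; lra.
have mm : m <= m <= 1 by have := m_lt1; lra.
have o1 : (0 <= 1 :> R) && (1 <= 1 :> R) by rewrite ler01 lexx.
have := sY _ o1; have := sX _ o1; have := sP _ o1; have := sS _ o1.
rewrite !mulr1 (YE m)// (XE m)// (PE m)// (SE m)//.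
move=> eS eP eX eY.
have m01 : 0 < m < 1 by rewrite m_gt0.
have e1 : Y 1 - (1 - m) = - m * Y 1 by rewrite eY; ring.
have e2 : X 1 + Y 1 * (1 - m) - (1 - m) ^+ 2 / 2 = - m ^+ 2 * X 1.
  by rewrite eX; ring.
have e3 : P 1 - X 1 * (1 - m) - Y 1 * (1 - m) ^+ 2 / 2 + (1 - m) ^+ 3 / 6 =
    - m ^+ 3 * P 1 by rewrite eP; ring.
have e4 : S 1 - P 1 * (1 - m) + X 1 * (1 - m) ^+ 2 / 2 + Y 1 * (1 - m) ^+ 3 / 6
    - (1 - m) ^+ 4 / 24 = - m ^+ 4 * S 1 by rewrite eS; ring.
have [f1 f2 S0] := fuller_amplitude0 m01 erefl m_root e1 e2 e3 e4.
have base t : m <= t <= 1 -> 0 <= S t.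
  move=> tm; rewrite SE// S0 add0r.
  apply: (fuller_quartic_ge0 m_bounds erefl f1 f2); last lra.
  by move: eS; rewrite S0 mulr0; lra.
have sgnS n t : m ^+ n.+1 <= t <= m ^+ n -> 0 <= (-1) ^+ n * S t.
  elim: n t => [|n IH] t; first by rewrite expr1 expr0 mul1r; exact: base.
  move=> /andP[t1 t2].
  have tE : t = m * (t / m) by rewrite mulrC divfK// gt_eqF.
  have tn : m ^+ n.+1 <= t / m <= m ^+ n.
    by rewrite ler_pdivlMr// ler_pdivrMr// -!exprSr t1.
  have t01 : 0 <= t / m <= 1.
    have /andP[? ?] := tn; apply/andP; split.
      by apply: le_trans (_ : m ^+ n.+1 <= _) => //; rewrite exprn_ge0// ltW.
    by apply: le_trans (_ : m ^+ n <= _) => //; rewrite exprn_ile1// ltW.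
  rewrite tE sS//.
  have -> : (-1) ^+ n.+1 * (m * (m * (m * (m * -1))) * S (t / m)) =
      m ^+ 4 * ((-1) ^+ n * S (t / m)).
    by rewrite [(-1) ^+ n.+1]exprS; move: ((-1) ^+ n) => e; ring.
  by apply: mulr_ge0; [rewrite exprn_ge0// ltW|exact: IH].
move=> t /(phase_exists m_gt0 m_lt1)[n tn].
rewrite /bang_sign (bangE m_gt0 m_lt1 tn) signr_odd; apply: sgnS.
by have /andP[-> /ltW->] := tn.
Qed.

End fuller_extremal.

(** * Optimality and uniqueness of the extremal curve *)

Section unit_speed.
Variable R : realType.
Implicit Types (v xi : carnot R).

(** The first component alone already has norm 1, so the other terms of the
    norm vanish. *)
Lemma finsler_unit v xi : xi@_1 = 1 -> finsler v xi = 1 ->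
  [/\ `|xi@_2| <= 1, xi@_3 = - v@_2, xi@_4 = - v@_3,
      xi@_5 = - (v@_1 * v@_3) & xi@_6 = v@_3 ^+ 2 / 2].
Proof.
rewrite /finsler => -> ; rewrite !mulr1.
set c3 := xi@_3 + _; set c4 := xi@_4 + _; set c5 := xi@_5 - _.
set c6 := _ - v@_2 * xi@_5 => F1.
have m1 : 1 <= Num.max `|1 : R| `|xi@_2| by rewrite le_max normr1 lexx.
have m2 : `|xi@_2| <= Num.max `|1 : R| `|xi@_2| by rewrite le_max lexx orbT.
have n3 := normr_ge0 c3; have n4 := normr_ge0 c4.
have n5 := normr_ge0 c5; have n6 := normr_ge0 c6.
have /eqP : `|c3| = 0 by lra.
rewrite normr_eq0 => /eqP z3.
have /eqP : `|c4| = 0 by lra.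
rewrite normr_eq0 => /eqP z4.
have /eqP : `|c5| = 0 by lra.
rewrite normr_eq0 => /eqP z5.
have /eqP : `|c6| = 0 by lra.
rewrite normr_eq0 => /eqP z6.
have x3 : xi@_3 = - v@_2 by move: z3; rewrite /c3; lra.
have x4 : xi@_4 = - v@_3 by move: z4; rewrite /c4; lra.
have x5 : xi@_5 = - (v@_1 * v@_3) by move: z5; rewrite /c5 x4; lra.
split=> //; first lra.
by apply/eqP; rewrite -subr_eq0 -z6 /c6 x4 x5; apply/eqP; field.
Qed.

End unit_speed.

Section extremal_curve.
Variables (R : realType) (m : R) (Y X P S Z4 Z5 Z6 : R -> R).
Hypotheses (m_gt0 : 0 < m) (m_lt1 : m < 1).
Hypotheses (pY : phase_prim m Y (bang_sign m)) (pX : phase_prim m X (fun t => - Y t)).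
Hypotheses (pP : phase_prim m P X) (pS : phase_prim m S P).
Hypothesis S_sign : forall t, 0 < t < 1 -> 0 <= bang_sign m t * S t.
Hypothesis p4 : phase_prim m Z4 (fun t => - X t).
Hypothesis p5 : phase_prim m Z5 (fun t => - (clip 0 1 t * X t)).
Hypothesis p6 : phase_prim m Z6 (fun t => X t ^+ 2 / 2).

(** The cut-off of t in the derivative of Z5 keeps that derivative bounded on
    the whole line; on [0, 1] it is - t X t. *)
Definition extremal (t : R) : carnot R := vec6 t (Y t) (X t) (Z4 t) (Z5 t) (Z6 t).
Let x := extremal.

Definition extremal_velocity (t : R) : 'rV[R]_6 :=
  gfield 1 (x t) + bang_sign m t *: gfield 2 (x t).

Lemma extremal_is_derive n t : m ^+ n.+1 < t < m ^+ n ->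
  is_derive t 1 x (extremal_velocity t).
Proof.
move=> tn; apply: crd_is_derive => k.
have ext (f1 f2 : R -> R) (d1 d2 : R) : f1 =1 f2 -> d1 = d2 ->
    is_derive t 1 f1 d1 -> is_derive t 1 f2 d2.
  by move=> /funext -> ->.
have [_ _ dY] := pY; have [_ _ dX] := pX.
have [_ _ d4] := p4; have [_ _ d5] := p5; have [_ _ d6] := p6.
have t01 := phase_unit m_gt0 m_lt1 tn.
case: k => [|[|[|[|[|[|[|k]]]]]]] // _.
- apply: ext (is_derive_id t 1) => [s|]; rewrite /x /extremal ?vec6E//.
  by rewrite /extremal_velocity crdD crdZ !vec6E; ring.
- apply: ext (dY n t tn) => [s|]; rewrite /x /extremal ?vec6E//.
  by rewrite /extremal_velocity crdD crdZ !vec6E; ring.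
- apply: ext (dX n t tn) => [s|]; rewrite /x /extremal ?vec6E//.
  by rewrite /extremal_velocity crdD crdZ !vec6E; ring.
- apply: ext (d4 n t tn) => [s|]; rewrite /x /extremal ?vec6E//.
  by rewrite /extremal_velocity crdD crdZ !vec6E; ring.
- apply: ext (d5 n t tn) => [s|]; rewrite /x /extremal ?vec6E//.
  rewrite /extremal_velocity crdD crdZ !vec6E clip_id; first ring.
  by move: t01; lra.
- apply: ext (d6 n t tn) => [s|]; rewrite /x /extremal ?vec6E//.
  by rewrite /extremal_velocity crdD crdZ !vec6E; field.
Qed.

Lemma extremal_derive1 :
  {ae lebesgue_measure, forall t, `]0, 1[%classic t -> derive1 x t = extremal_velocity t}.
Proof.
apply: (ae_phase m_gt0 m_lt1) => n t tn; rewrite derive1E.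
by have [_ <-] := extremal_is_derive tn.
Qed.

Lemma extremal_natural : natural 1 x.
Proof.
move: extremal_derive1; apply: filterS => t h /h ->.
have -> : extremal_velocity t = 1 *: gfield 1 (x t) + bang_sign m t *: gfield 2 (x t)
    + 0 *: gfield 3 (x t) + 0 *: gfield 4 (x t) + 0 *: gfield 5 (x t) + 0 *: gfield 6 (x t).
  by rewrite !scale0r !addr0 scale1r.
rewrite finsler_frame !normr0 !addr0 normr1 /bang_sign normrX normrN1 expr1n.
by rewrite maxxx.
Qed.

Lemma extremal_connects : connects (x 0) (x 1) 1 x.
Proof.
split=> //; apply: lipschitz_abs_continuous => k s t k6 s0 st t1.
have ger0 : `|t - s| = t - s by rewrite ger0_norm ?subr_ge0.
have [_ lY _] := pY; have [_ lX _] := pX; have [_ l4 _] := p4.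
have [_ l5 _] := p5; have [_ l6 _] := p6; rewrite -[leRHS]ger0.
by case: k k6 => [|[|[|[|[|[|[|k]]]]]]] // _; rewrite /x /extremal !vec6E.
Qed.

Lemma extremal_shortest : shortest (x 0) (x 1) 1 x.
Proof.
split=> [|T y /length_ge_crd1]; first exact: extremal_connects.
rewrite (length_natural ler01 extremal_natural).
by rewrite /x /extremal !vec6E subr0.
Qed.

(** Let d, e be the deviations of y from the extremal in x_3 and x_2. The function
    (y_6 - Z6) - (P d + S e) has derivative d^2 / 2 + S (w - y_2'), since
    P' = X, S' = P and d' = - e. The second term is nonnegative because w is the
    sign of S and [|y_2'| <= 1]. The endpoints being the same, the function takes
    the value 0 at 0 and at 1, so its derivative vanishes, and with it d. *)
Lemma competitor_eq y : connects (x 0) (x 1) 1 y -> natural 1 y ->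
  {in `[0, 1], y =1 x}.
Proof.
move=> [_ acy y0 y1] ny.
have D k := crd_prim k (@ltr01 R) acy.
have qY := phase_prim_prim m_gt0 m_lt1 pY; have qX := phase_prim_prim m_gt0 m_lt1 pX.
have qP := phase_prim_prim m_gt0 m_lt1 pP; have qS := phase_prim_prim m_gt0 m_lt1 pS.
have q4 := phase_prim_prim m_gt0 m_lt1 p4; have q5 := phase_prim_prim m_gt0 m_lt1 p5.
have q6 := phase_prim_prim m_gt0 m_lt1 p6.
have o0 : 0 <= (0 : R) <= 1 by rewrite lexx ler01.
(* the first coordinate is time *)
have [||t_y1 dt_y1] := prim_monotone_loop (primB (prim_id 0 1) (D 1%N)).
- by rewrite /= y0 y1 /x /extremal !vec6E; ring.
- move: ny; apply: filterS => t h /h F1 /=; rewrite subr_ge0 -F1.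
  by apply: le_trans (ler_norm _) _; exact: finsler_crd1.
have y1t t : 0 <= t <= 1 -> (y t)@_1 = t.
  by move=> /t_y1 /=; rewrite y0 /x /extremal !vec6E; lra.
have vel : {ae lebesgue_measure, forall t, `]0, 1[%classic t ->
    [/\ `|(derive1 y t)@_2| <= 1, (derive1 y t)@_3 = - (y t)@_2,
      (derive1 y t)@_4 = - (y t)@_3, (derive1 y t)@_5 = - (t * (y t)@_3) &
      (derive1 y t)@_6 = (y t)@_3 ^+ 2 / 2]}.
  move: ny dt_y1; apply: filterS2 => t h1 h2 t01.
  have [|? ? ? E ?] := finsler_unit _ (h1 t01); first by have := h2 t01; rewrite /=; lra.
  split=> //; rewrite E y1t//; move: t01; rewrite /= in_itv/=; lra.
pose d t := (y t)@_3 - X t; pose e t := (y t)@_2 - Y t.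
pose dd t := (derive1 y t)@_3 + Y t; pose de t := (derive1 y t)@_2 - bang_sign m t.
have pd : prim 0 1 d dd.
  by apply: prim_eq (primB (D 3%N) qX) => t _ /=; rewrite opprK.
have pe : prim 0 1 e de by exact: (primB (D 2%N) qY).
have pG := primB (primB (D 6%N) q6) (primD (primM ler01 qP pd) (primM ler01 qS pe)).
have Y0 : Y 0 = 0 by case: pY.
have X0 : X 0 = 0 by case: pX.
have d0 : d 0 = 0 by rewrite /d y0 /x /extremal !vec6E subrr.
have e0 : e 0 = 0 by rewrite /e y0 /x /extremal !vec6E subrr.
have control_ge0 t u : 0 < t < 1 -> `|u| <= 1 -> 0 <= S t * (bang_sign m t - u).
  move=> /S_sign + /ler_normlP[u1 u2].
  rewrite /bang_sign; case: (bang m t); rewrite /= ?expr1 ?expr0 => Sw.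
    rewrite -mulrNN mulr_ge0//; first by move: Sw; rewrite mulN1r.
    by lra.
  by rewrite mulr_ge0//; [move: Sw; rewrite mul1r|lra].
have GE t : (derive1 y t)@_3 = - (y t)@_2 -> (derive1 y t)@_6 = (y t)@_3 ^+ 2 / 2 ->
  (derive1 y t)@_6 - X t ^+ 2 / 2 - (P t * dd t + d t * X t + (S t * de t + e t * P t)) =
  d t ^+ 2 / 2 + S t * (bang_sign m t - (derive1 y t)@_2).
  by move=> E3 E6; rewrite E6 /dd E3 /de /d /e; field.
have [||_ G0] := prim_monotone_loop pG.
- by rewrite /= d0 e0 /d /e y0 y1 /x /extremal !vec6E; ring.
- move: vel; apply: filterS => t h t01; have [u1 E3 E4 E5 E6] := h t01.
  rewrite /= GE// addr_ge0//; first by rewrite divr_ge0// sqr_ge0.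
  by apply: control_ge0 => //; move: t01; rewrite /= in_itv.
have dz : forall t, 0 <= t <= 1 -> d t = 0.
  apply: (prim_ae0 pd d0); move: vel G0; apply: filterS2 => t h g t01.
  have [u1 E3 E4 E5 E6] := h t01; have := g t01; rewrite /= GE// => sum0.
  have : 0 <= S t * (bang_sign m t - (derive1 y t)@_2).
    by apply: control_ge0 => //; move: t01; rewrite /= in_itv.
  have := sqr_ge0 (d t) => sq0 c0.
  by apply/eqP; rewrite -sqrf_eq0; apply/eqP; lra.
have ez : forall t, 0 <= t <= 1 -> e t = 0.
  apply: (prim_ae0 pe e0).
  move: vel (prim_derive_eq dz pd (prim_cst 0 1 0)).
  apply: filterS2 => t h g t01; have [u1 E3 E4 E5 E6] := h t01.
  by have := g t01; rewrite /= /dd E3 /e; lra.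
move=> t; rewrite in_itv/= => t01.
have y2 : (y t)@_2 = Y t by have := ez t t01; rewrite /e; lra.
have y3 s : 0 <= s <= 1 -> (y s)@_3 = X s by move=> /dz; rewrite /d; lra.
have in01 s : `]0, 1[%classic s -> 0 <= s <= 1.
  by rewrite /= in_itv/= => /andP[/ltW-> /ltW].
apply: crdP; rewrite [in RHS]/x /extremal ?vec6E.
- exact: y1t.
- exact: y2.
- exact: y3.
- apply: (prim_uniq (prim_ae_eq _ (D 4%N)) q4 _ t01).
    move: vel; apply: filterS => s h s01; have [_ _ -> _ _] := h s01.
    by rewrite y3 ?in01.
  by rewrite y0 /x /extremal !vec6E.
- apply: (prim_uniq (prim_ae_eq _ (D 5%N)) q5 _ t01).
    move: vel; apply: filterS => s h s01; have [_ _ _ -> _] := h s01.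
    by rewrite y3 ?clip_id ?in01.
  by rewrite y0 /x /extremal !vec6E.
- apply: (prim_uniq (prim_ae_eq _ (D 6%N)) q6 _ t01).
    move: vel; apply: filterS => s h s01; have [_ _ _ _ ->] := h s01.
    by rewrite y3 ?in01.
  by rewrite y0 /x /extremal !vec6E.
Qed.

Lemma extremal_unique_shortest : unique_shortest (x 0) (x 1) 1 x.
Proof.
split; [exact: extremal_shortest|exact: extremal_natural|].
move=> T y [cy miny] ny; have [cx minx] := extremal_shortest.
have T0 : 0 <= T by case: cy.
have T1 : T = 1.
  have h1 := minx _ _ cy; have h2 := miny _ _ cx; move: h1 h2.
  rewrite (length_natural T0 ny) (length_natural ler01 extremal_natural) !lee_fin.
  by move=> h1 h2; apply/le_anti; rewrite h1 h2.
by split=> //; move: cy ny; rewrite T1; exact: competitor_eq.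
Qed.

(** * Chattering of the extremal curve *)

Definition extremal_control (v : vertex) (t : R) : R :=
  (v == inl (false, bang m t))%:R.

Lemma extremal_is_control : is_control 1 x extremal_control.
Proof.
split.
- move=> v; rewrite (_ : extremal_control v = fun t =>
    (v == inl (false, false))%:R + ((v == inl (false, true))%:R
      - (v == inl (false, false))%:R) * \1_(negative_phases m) t); last first.
    apply/funext => t; rewrite /extremal_control /bang indicE.
    case: asboolP => h; [rewrite mem_set//|rewrite memNset//];
      by rewrite ?mulr1 ?mulr0; ring.
  apply: measurable_realfun.measurable_funD => //.
  apply: measurable_realfun.measurable_funM => //.
  by apply: measurable_realfun.measurable_indic; exact: measurable_negative_phases.
- move=> t _; split=> [v|]; first exact: ler0n.
  rewrite (bigD1 (inl (false, bang m t)))//= /extremal_control eqxx big1 ?addr0//.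
  by move=> v /negbTE ->.
- move: extremal_derive1; apply: filterS => t h /h ->.
  rewrite (bigD1 (inl (false, bang m t)))//= /extremal_control eqxx big1 ?addr0//.
    by rewrite expr0 !scale1r.
  by move=> v /negbTE ->; rewrite scale0r.
Qed.

Lemma extremal_control_phase n t v : m ^+ n.+1 <= t < m ^+ n ->
  extremal_control v t = 1 -> v = inl (false, odd n).
Proof.
move=> tn; rewrite /extremal_control (bangE m_gt0 m_lt1 tn).
by case: eqP => // _ /eqP; rewrite eq_sym oner_eq0.
Qed.

(** Away from the powers of m the control is locally constant, so it has the
    same one-sided limits. *)
Lemma extremal_switches :
  switches 1 extremal_control = [set m ^+ n.+1 | n in [set: nat]].
Proof.
apply/seteqP; split=> [t [/=]|_ [n _ <-]].
  rewrite in_itv/= => t01 [v [w [vw vt wt]]].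
  have [n /andP[n1 n2]] := phase_exists m_gt0 m_lt1 t01.
  have [tn|tn] := eqVneq t (m ^+ n.+1); first by exists n.
  have lt_n : m ^+ n.+1 < t < m ^+ n by rewrite lt_neqAle eq_sym tn n1.
  have nt := near_phase lt_n.
  have vE : v = inl (false, odd n).
    near (t^'-) => s; apply: (@extremal_control_phase n s); last by near: s.
    by near: s; exact: cvg_at_left_filter nt.
  have wE : w = inl (false, odd n).
    near (t^'+) => s; apply: (@extremal_control_phase n s); last by near: s.
    by near: s; exact: cvg_at_right_filter nt.
  by rewrite vE wE eqxx in vw.
split.
  by rewrite /= in_itv/= exprn_gt0//= exprn_ilt1// ltW.
exists (inl (false, odd n.+1)), (inl (false, odd n)); split.
- by apply/eqP => -[]; case: odd.
- have := near_left_phase m_gt0 m_lt1 n.+1; apply: filterS => s sn.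
  by rewrite /extremal_control (bangE m_gt0 m_lt1 sn) eqxx.
- have := near_right_phase m_gt0 m_lt1 n; apply: filterS => s sn.
  by rewrite /extremal_control (bangE m_gt0 m_lt1 sn) eqxx.
Unshelve. all: by end_near. Qed.

Lemma extremal_chattering : chattering 1 x.
Proof.
exists extremal_control; first exact: extremal_is_control.
exists 0 => [|e e0]; first by rewrite /= in_itv/= lexx ler01.
rewrite extremal_switches.
have ex : exists n, m ^+ n.+1 < e.
  have [N Ne] := expr_small m_gt0 m_lt1 e0; exists N.
  by apply: le_lt_trans Ne; rewrite exprS ler_piMl ?exprn_ge0// ltW.
(* the switching times below e are the powers of exponent larger than N *)
case: (ex_minnP ex) => N Ne Nmin.
rewrite (_ : _ `&` _ = [set m ^+ (n + N).+1 | n in [set: nat]]).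
  apply: inj_card_eq => n k _ _ E; apply/eqP.
  by rewrite -(eqn_add2r N) -eqSS eqn_leq -!(ler_iXn2l m_gt0 m_lt1) E lexx.
apply/seteqP; split=> [_ [[n _ <-]]|_ [n _ <-]] /=; rewrite in_itv/= ?sub0r ?add0r.
  move=> /andP[_ ne]; exists (n - N)%N => //; rewrite subnK//; exact: Nmin.
split; first by exists (n + N)%N.
rewrite (lt_trans _ (exprn_gt0 _ m_gt0)) ?oppr_lt0//=.
by apply: le_lt_trans Ne; rewrite ler_wiXn2l ?ltnS ?leq_addl// ltW.
Qed.

End extremal_curve.


Theorem theorem5 (R : realType) :
  exists (p q : carnot R) (T : R) (x : R -> carnot R),
    unique_shortest p q T x /\ chattering T x.
Proof.
have [m [m_bounds m_root]] := @fuller_ratio_exists R.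
have m_gt0 : 0 < m by lra.
have m_lt1 : m < 1 by lra.
have [Y [X [P [S [pY pX pP pS [Y1 X1 SE]]]]]] := fuller_extremal_exists m_bounds m_root.
have cX : continuous X by apply: lip1_continuous; case: pX.
have [||Z4 [p4 _]] := @continuous_phase_prim_exists R m m_bounds (fun t => - X t).
- by move=> t; apply: cvgN; exact: cX.
- by move=> t; rewrite normrN.
have [||Z5 [p5 _]] := @continuous_phase_prim_exists R m m_bounds (fun t => - (clip 0 1 t * X t)).
- move=> t; apply: cvgN; apply: cvgM; last exact: cX.
  exact: (lip1_continuous (@lip1_clip R)).
- move=> t; rewrite normrN normrM.
  have /andP[c0 c1] := clip_itv t (@ler01 R).
  by rewrite ger0_norm// mulr_ile1.
have [||Z6 [p6 _]] := @continuous_phase_prim_exists R m m_bounds (fun t => X t ^+ 2 / 2).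
- move=> t; apply: cvgM; last exact: cvg_cst.
  by rewrite expr2; apply: cvgM; exact: cX.
- move=> t; rewrite ger0_norm ?divr_ge0 ?sqr_ge0// ler_pdivrMr// mul1r.
  by rewrite -real_normK ?num_real// (le_trans (exprn_ile1 _ _ _))// ler1n.
exists (extremal Y X Z4 Z5 Z6 0), (extremal Y X Z4 Z5 Z6 1), 1, (extremal Y X Z4 Z5 Z6).
split; [exact: (extremal_unique_shortest m_gt0 m_lt1 pY pX pP pS SE p4 p5 p6)|].
exact: (extremal_chattering m_gt0 m_lt1 pY pX p4 p5 p6).
Qed.
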